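(* Let $k$ be a field, let $G$ be a graph with vertex set $I$, let $\lambda\in k^I$, let $\Pi^\lambda$ be the deformed preprojective algebra of $G$, and let $B\subset \Pi^\lambda$ be the image of the space of paths of length zero under the canonical projection $kG\to\Pi^\lambda$. (a) Assume $G$ is of finite $ADE$ type and $\mathrm{char}\,k$ is good for $G$. Then $$\Pi^\lambda=[\Pi^\lambda,\Pi^\lambda]+B.$$ (b) Assume $G$ is of affine $\widehat{ADE}$ type and $\mathrm{char}\,k$ is good for $G$. Then $$\Pi^\lambda=[\Pi^\lambda,\Pi^\lambda]+\Pi^\lambda_{i_0i_0}+B,$$ where $i_0\in I$ is a chosen extending vertex and $\Pi^\lambda_{i_0i_0}=e_{i_0}\cdot\Pi^\lambda\cdot e_{i_0}$ is the subalgebra of $\Pi^\lambda$ consisting of all paths beginning and ending at $i_0$.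
   Context: $G$ is a non-oriented graph with vertex set $I$ and edge set $H$. Finite $ADE$ type means that $G$ is a connected simply laced Dynkin graph ($A_n$, $D_n$, $E_6$, $E_7$, $E_8$); affine $\widehat{ADE}$ type means that $G$ is a connected simply laced extended Dynkin graph. A vertex of an affine Dynkin graph is extending if by removing it one obtains a connected Dynkin graph of finite type. The path algebra $kG$ is the $k$-vector space spanned by all paths in $G$ (edges may be traversed in either direction), with multiplication $\cdot$ given by concatenation; $e_i$ is the trivial path at $i$, and $k^I$ is identified with the subalgebra of $kG$ spanned by the trivial paths, so $\lambda=\sum_i\lambda_ie_i\in kG$. For $i\in I$, $a\in H$, let $\theta_i^a$ be the path of length two from $i$ to $i$ along $a$ and back along $a$ if $i$ is an end-vertex of $a$, and $0$ otherwise; put $\theta=\sum_{i\in I,\,a\in H}\theta_i^a$. The deformed preprojective algebra is $\Pi^\lambda=kG/(\theta-\lambda)$, the quotient by the two-sided ideal generated by $\theta-\lambda$. For an associative $k$-algebra $R$, $[R,R]$ denotes the $k$-span of $\{ab-ba : a,b\in R\}$. A prime $p$ is bad for a simply laced Dynkin graph $G$ in exactly the following cases: $p=2$ for type $D_n$; $p=2$ or $3$ for type $E_6$ or $E_7$; $p=2$, $3$ or $5$ for type $E_8$ (no bad primes in type $A$). If $G$ is affine, $p$ is bad for $G$ if it is bad for the corresponding non-extended Dynkin graph. A prime which is not bad is good. ''$\mathrm{char}\,k$ is good for $G$'' means that $\mathrm{char}\,k$ is $0$ or a good prime. *)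

(* Defs.v *)
From HB Require Import structures.
From mathcomp Require Import all_boot all_order all_algebra.
From mathcomp Require Import finmap boolp classical_sets monalg.

Set Implicit Arguments.
Unset Strict Implicit.
Unset Printing Implicit Defensive.

Import GRing.Theory.
Local Open Scope ring_scope.

(* Non-oriented finite graphs, possibly with multiple edges, without loops.   *)
Record graph := Graph {
  vtx : finType;
  edge : finType;
  ends : edge -> {set vtx};
  card_ends : forall a, #|ends a| = 2%N
}.

(* A diagram (n, s) is the graph on {0, ..., n-1} whose edges are the entries *)
(* of s, each one joining the two listed vertices.                            *)
Definition diagram := (nat * seq (nat * nat))%type.

Definition has_diagram (G : graph) (d : diagram) : Prop :=
  exists (f : vtx G -> 'I_d.1) (g : edge G -> 'I_(size d.2)),
    [/\ bijective f, bijective g &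
        forall (a : edge G) (i : vtx G),
          (i \in ends a) =
          ((f i : nat) \in [:: (nth (0, 0)%N d.2 (g a)).1;
                               (nth (0, 0)%N d.2 (g a)).2])].

(* The chain 0 - 1 - ... - (n-1).                                             *)
Definition chain (n : nat) : seq (nat * nat) := [seq (i, i.+1) | i <- iota 0 n.-1].

Inductive dynkin := DynA of nat | DynD of nat | DynE6 | DynE7 | DynE8.

Definition valid_dynkin (t : dynkin) : bool :=
  match t with DynA n => (0 < n)%N | DynD n => (4 <= n)%N | _ => true end.

Definition finite_diagram (t : dynkin) : diagram :=
  match t with
  | DynA n => (n, chain n)
  | DynD n => (n, rcons (chain n.-1) (n - 3, n.-1)%N)
  | DynE6 => (6, rcons (chain 5) (2, 5))%N
  | DynE7 => (7, rcons (chain 6) (2, 6))%N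
  | DynE8 => (8, rcons (chain 7) (2, 7))%N
  end.

(* The affine diagram of type A_1 consists of two vertices joined by a double *)
(* edge.                                                                      *)
Definition affine_diagram (t : dynkin) : diagram :=
  match t with
  | DynA n => (n.+1, rcons (chain n.+1) (n, 0))%N
  | DynD n => (n.+1, chain n.-1 ++ [:: (n - 3, n.-1); (1, n)])%N
  | DynE6 => (7, chain 5 ++ [:: (2, 5); (5, 6)])%N
  | DynE7 => (8, rcons (chain 7) (3, 7))%N
  | DynE8 => (9, rcons (chain 8) (2, 8))%N
  end.

Definition of_finite_type (G : graph) (t : dynkin) : Prop :=
  valid_dynkin t /\ has_diagram G (finite_diagram t).
Definition of_affine_type (G : graph) (t : dynkin) : Prop :=
  valid_dynkin t /\ has_diagram G (affine_diagram t).

Definition finite_ADE (G : graph) : Prop := exists t, of_finite_type G t.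
Definition affine_ADE (G : graph) : Prop := exists t, of_affine_type G t.

Definition bad_for_type (p : nat) (t : dynkin) : bool :=
  match t with
  | DynA _ => false
  | DynD _ => p == 2
  | DynE6 | DynE7 => p \in [:: 2; 3]
  | DynE8 => p \in [:: 2; 3; 5]
  end%N.

Definition bad_prime (p : nat) (G : graph) : Prop :=
  exists2 t, of_finite_type G t \/ of_affine_type G t & bad_for_type p t.

(* [pchar k] is empty in characteristic 0, and {p} in characteristic p.       *)
Definition good_char (k : fieldType) (G : graph) : Prop :=
  forall p, p \in [pchar k] -> ~ bad_prime p G.

Section DelVertex.
Variables (G : graph) (i0 : vtx G).

Let dvtx : finType := {i : vtx G | i != i0}.
Let dedge : finType := {a : edge G | i0 \notin ends a}.
Let dends (a : dedge) : {set dvtx} := finset (fun i => val i \in ends (val a)).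

Fact del_card_ends a : #|dends a| = 2%N.
Proof.
rewrite -(card_ends (val a)) -(card_imset (mem (dends a)) val_inj).
apply: eq_card => i; apply/imsetP/idP => [[j]|ia].
  by rewrite inE => ? ->.
have ni : i != i0 by apply: contraTneq ia => ->; exact: (valP a).
by exists (Sub i ni); rewrite ?inE ?SubK.
Qed.

Definition del_vertex : graph := Graph del_card_ends.
End DelVertex.

Definition extending (G : graph) (i0 : vtx G) : Prop :=
  finite_ADE (del_vertex i0).

Section Subspaces.
Local Open Scope classical_set_scope.

Definition span (k : fieldType) (V : lmodType k) (S : set V) : set V :=
  [set x | exists n (c : 'I_n -> k) (v : 'I_n -> V),
      (forall i, S (v i)) /\ x = \sum_i c i *: v i].

Definition sumsp (V : zmodType) (S T : set V) : set V :=
  [set x + y | x in S & y in T].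

Definition commutators (A : pzRingType) : set A :=
  [set a * b - b * a | a in setT & b in setT].

Definition corner (A : pzRingType) (e : A) : set A :=
  [set e * x * e | x in setT].

(* The two-sided ideal generated by r.                                        *)
Definition ideal_gen (A : pzRingType) (r : A) : set A :=
  [set x | exists n (a b : 'I_n -> A), x = \sum_i a i * r * b i].
End Subspaces.

(* A path is a pair (i, [:: (a_1, i_1); ...; (a_n, i_n)]) such that the edge  *)
(* a_m joins i_(m-1) and i_m, where i_0 = i.                                  *)
Section Paths.
Variable G : graph.

Definition step : Type := (edge G * vtx G)%type.

Fixpoint walk (i : vtx G) (s : seq step) : bool :=
  if s is (a, j) :: s' then (ends a == [set i; j]%SET) && walk j s'
  else true.

Fixpoint walk_end (i : vtx G) (s : seq step) : vtx G :=
  if s is (_, j) :: s' then walk_end j s' else i.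

Record gpath := GPath {
  gpath_val :> vtx G * seq step;
  _ : walk gpath_val.1 gpath_val.2
}.
HB.instance Definition _ := [isSub for gpath_val].
(* These two instances are sealed: unifying their unfolded forms is           *)
(* prohibitively slow.                                                        *)
Fact gpath_hasDecEq : hasDecEq gpath.
Proof. exact: (Equality.on (sub_type gpath)). Qed.
HB.instance Definition _ := gpath_hasDecEq.
Fact gpath_hasChoice : hasChoice gpath.
Proof. exact: (Choice.on (sub_type gpath)). Qed.
HB.instance Definition _ := gpath_hasChoice.

Definition src (p : gpath) : vtx G := p.1.
Definition steps (p : gpath) : seq step := p.2.
Definition tgt (p : gpath) : vtx G := walk_end (src p) (steps p).

Lemma walk_cat i s t : walk i (s ++ t) = walk i s && walk (walk_end i s) t.
Proof. by elim: s i => //= -[a j] s IH i; rewrite IH andbA. Qed.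

Lemma walk_end_cat i s t : walk_end i (s ++ t) = walk_end (walk_end i s) t.
Proof. by elim: s i => //= -[]. Qed.
End Paths.

Section PathAlgebra.
Variables (k : fieldType) (G : graph).

Definition pathalg := {malg k[gpath G]}.
HB.instance Definition _ := GRing.Lmodule.on pathalg.

(* The basis element of the path (i, s); it is 0 if (i, s) is not a path.     *)
Definition path_elt (i : vtx G) (s : seq (step G)) : pathalg :=
  if insub (i, s) is Some p then << p >> else 0.

Definition path_cat (p q : gpath G) : pathalg :=
  if tgt p == src q then path_elt (src p) (steps p ++ steps q) else 0.

End PathAlgebra.

HB.lock Definition pamul (k : fieldType) (G : graph) (x y : pathalg k G) :
    pathalg k G :=
  \sum_(p <- msupp x) \sum_(q <- msupp y) (x@_p * y@_q) *: path_cat k p q.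

Section PathAlgebraTheory.
Variables (k : fieldType) (G : graph).
Local Notation pathalg := (pathalg k G).
Local Notation path_elt := (@path_elt k G).
Local Notation path_cat := (@path_cat k G).
Local Notation pamul := (@pamul k G).
Implicit Types (x y z : pathalg) (c : k) (p q r : gpath G) (i : vtx G).

Definition idp (i : vtx G) : pathalg := path_elt i [::].

Definition paone : pathalg := \sum_i idp i.

Fact path_eltE (p : gpath G) : path_elt (src p) (steps p) = << p >>.
Proof. by rewrite /path_elt /src /steps -surjective_pairing valK. Qed.

(* Linear extension of a map defined on paths.                                *)
Definition lext (h : gpath G -> pathalg) (x : pathalg) : pathalg :=
  \sum_(p <- msupp x) x@_p *: h p.

Fact lextw h x (d : {fset gpath G}) : (msupp x `<=` d)%fset ->
  lext h x = \sum_(p <- d) x@_p *: h p.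
Proof.
move=> sub; rewrite /lext (big_fset_incl _ sub) // => p _ /mcoeff_outdom ->.
by rewrite scale0r.
Qed.

Fact lextP h c x y : lext h (c *: x + y) = c *: lext h x + lext h y.
Proof.
pose d := (msupp x `|` msupp y)%fset.
have sub : (msupp (c *: x + y) `<=` d)%fset.
  apply: fsubset_trans (msuppD_le _ _) _.
  by rewrite fsetSU // msuppZ_le.
rewrite (lextw h sub) (lextw h (fsubsetUl _ _ : msupp x `<=` d)%fset).
rewrite (lextw h (fsubsetUr _ _ : msupp y `<=` d)%fset).
rewrite scaler_sumr -big_split; apply: eq_bigr => p _ /=.
by rewrite mcoeffD mcoeffZ scalerDl scalerA.
Qed.

Fact lextD h x y : lext h (x + y) = lext h x + lext h y.
Proof. by have := lextP h 1 x y; rewrite !scale1r. Qed.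

Fact lext0 h : lext h 0 = 0.
Proof. by rewrite /lext msupp0 big_seq_fset0. Qed.

Fact lextZ h c x : lext h (c *: x) = c *: lext h x.
Proof. by rewrite -[c *: x]addr0 lextP lext0 addr0. Qed.

Fact lext_sum h (I : Type) (s : seq I) (P : pred I) (F : I -> pathalg) :
  lext h (\sum_(i <- s | P i) F i) = \sum_(i <- s | P i) lext h (F i).
Proof. exact: (big_morph (lext h) (lextD h) (lext0 h)). Qed.

Fact lextU h p : lext h << p >> = h p.
Proof.
rewrite (@lextw _ _ [fset p]%fset) ?msuppU_le // big_seq_fset1.
by rewrite mcoeffUU scale1r.
Qed.

Fact lext_ext h h' x : h =1 h' -> lext h x = lext h' x.
Proof. by move=> e; apply: eq_bigr => p _; rewrite e. Qed.

Fact lext_id x : lext (fun p => << p >>) x = x.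
Proof.
rewrite [RHS]monalgE; apply: eq_bigr => p _; apply/malgP => q.
rewrite mcoeffZ 2!mcoeffU.
by case: (p == q); [exact: mulr1 | exact: mulr0].
Qed.

Fact pamulE x y : pamul x y = lext (fun p => lext (path_cat p) y) x.
Proof.
rewrite pamul.unlock; apply: eq_bigr => p _; rewrite scaler_sumr; apply: eq_bigr => q _.
by rewrite scalerA.
Qed.

Fact pamulDl : left_distributive pamul +%R.
Proof. by move=> x y z; rewrite !pamulE lextD. Qed.

Fact pamulDr : right_distributive pamul +%R.
Proof.
move=> x y z; rewrite !pamulE -big_split; apply: eq_bigr => p _ /=.
by rewrite lextD scalerDr.
Qed.

Fact pamulZl c x y : pamul (c *: x) y = c *: pamul x y.
Proof. by rewrite !pamulE lextZ. Qed.

Fact pamulZr c x y : pamul x (c *: y) = c *: pamul x y.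
Proof.
rewrite !pamulE [RHS]scaler_sumr; apply: eq_bigr => p _.
by rewrite lextZ !scalerA mulrC.
Qed.

Fact pamul0l y : pamul 0 y = 0.
Proof. by rewrite pamulE lext0. Qed.

Fact pamul0r x : pamul x 0 = 0.
Proof. by rewrite pamulE {1}/lext big1 // => p _; rewrite lext0 scaler0. Qed.

Fact pamul_suml (I : Type) (s : seq I) (P : pred I) (F : I -> pathalg) y :
  pamul (\sum_(i <- s | P i) F i) y = \sum_(i <- s | P i) pamul (F i) y.
Proof.
exact: (big_morph (pamul^~ y) (fun a b => pamulDl a b y) (pamul0l y)).
Qed.

Fact pamul_sumr (I : Type) (s : seq I) (P : pred I) (F : I -> pathalg) x :
  pamul x (\sum_(i <- s | P i) F i) = \sum_(i <- s | P i) pamul x (F i).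
Proof. exact: (big_morph (pamul x) (pamulDr x) (pamul0r x)). Qed.

Fact pamulU p q : pamul << p >> << q >> = path_cat p q.
Proof. by rewrite pamulE !lextU. Qed.

Fact pathalg_ind (P : pathalg -> Prop) :
  P 0 -> (forall c p y, P y -> P (c *: << p >> + y)) -> forall x, P x.
Proof.
move=> P0 PD x; rewrite -[x]lext_id /lext.
by elim: (msupp x : seq _) => [|p s IH]; rewrite ?big_nil ?big_cons //; apply: PD.
Qed.

Fact path_elt_walk i s (w : walk i s) : path_elt i s = << GPath (gpath_val := (i, s)) w >>.
Proof. by rewrite -path_eltE. Qed.

Fact path_catA p q r :
  pamul (path_cat p q) << r >> = pamul << p >> (path_cat q r).
Proof.
have w (u : gpath G) : walk (src u) (steps u) by exact: (valP u).
rewrite /path_cat.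
case: (altP (tgt p =P src q)) => [pq|npq];
  case: (altP (tgt q =P src r)) => [qr|nqr]; last first.
- by rewrite pamul0l pamul0r.
- have wqr : walk (src q) (steps q ++ steps r).
    by rewrite walk_cat w -/(tgt q) qr w.
  by rewrite pamul0l (path_elt_walk wqr) pamulU /path_cat (negPf npq).
- have wpq : walk (src p) (steps p ++ steps q).
    by rewrite walk_cat w -/(tgt p) pq w.
  rewrite (path_elt_walk wpq) pamulU /path_cat.
  rewrite /tgt /src /steps /= walk_end_cat -/(src p) -/(steps p) -/(tgt p).
  by rewrite pq -/(src q) -/(steps q) -/(tgt q)
    (negPf nqr) pamul0r.
- have wpq : walk (src p) (steps p ++ steps q).
    by rewrite walk_cat w -/(tgt p) pq w.
  have wqr : walk (src q) (steps q ++ steps r).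
    by rewrite walk_cat w -/(tgt q) qr w.
  rewrite (path_elt_walk wpq) (path_elt_walk wqr) !pamulU /path_cat.
  rewrite /tgt /src /steps /= walk_end_cat -/(src p) -/(steps p) -/(tgt p).
  by rewrite pq -/(src q) -/(steps q) -/(tgt q) qr !eqxx catA.
Qed.

Fact pamulA : associative pamul.
Proof.
have A3 p q z : pamul << p >> (pamul << q >> z) = pamul (pamul << p >> << q >>) z.
  move: z; apply: pathalg_ind => [|c r z IH]; first by rewrite !pamul0r.
  by rewrite !(pamulDr, pamulZr) IH !pamulU path_catA.
have A2 p y z : pamul << p >> (pamul y z) = pamul (pamul << p >> y) z.
  move: y; apply: pathalg_ind => [|c q y IH].
    by rewrite pamul0r pamul0l pamul0r.
  by rewrite pamulDl pamulZl 2!pamulDr 2!pamulZr pamulDl pamulZl IH A3.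
move=> x y z; move: x; apply: pathalg_ind => [|c p x IH].
  by rewrite !pamul0l.
by rewrite 3!pamulDl 3!pamulZl IH A2.
Qed.

Fact idp_walk i : idp i = << GPath (gpath_val := (i, [::])) isT >>.
Proof. exact: path_elt_walk. Qed.

Fact paone_l p : pamul paone << p >> = << p >>.
Proof.
rewrite pamul_suml (bigD1 (src p)) //= big1 => [|i ni]; rewrite idp_walk pamulU.
  by rewrite /path_cat eqxx addr0; exact: path_eltE.
by rewrite /path_cat /tgt /= (negPf ni).
Qed.

Fact paone_r p : pamul << p >> paone = << p >>.
Proof.
rewrite pamul_sumr (bigD1 (tgt p)) //= big1 => [|i ni]; rewrite idp_walk pamulU.
  by rewrite /path_cat eqxx addr0 cats0; exact: path_eltE.
by rewrite /path_cat eq_sym (negPf ni).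
Qed.

Fact pamul1l : left_id paone pamul.
Proof.
apply: pathalg_ind => [|c p x IH]; first exact: pamul0r.
by rewrite pamulDr pamulZr IH paone_l.
Qed.

Fact pamul1r : right_id paone pamul.
Proof.
apply: pathalg_ind => [|c p x IH]; first exact: pamul0l.
by rewrite pamulDl pamulZl IH paone_r.
Qed.

(* pathalg is only a pzRingType and an lmodType: the algType structure of the *)
(* library excludes the zero algebra, which does occur among the quotients    *)
(* below.                                                                     *)
HB.instance Definition _ := GRing.Zmodule_isPzRing.Build pathalg
  pamulA pamul1l pamul1r pamulDl pamulDr.

Fact pascaleAl c (x y : pathalg) : c *: (x * y) = (c *: x) * y.
Proof. by rewrite -pamulZl. Qed.

Fact pascaleAr c (x y : pathalg) : c *: (x * y) = x * (c *: y).
Proof. by rewrite -pamulZr. Qed.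
End PathAlgebraTheory.

Section QuotientAlgebra.
Variables (k : fieldType) (G : graph).
Local Notation A := (pathalg k G).
Variable r : A.

Definition in_ideal : {pred A} := fun x => `[< ideal_gen r x >].

Fact in_idealP x : reflect (ideal_gen r x) (x \in in_ideal).
Proof. exact: asboolP. Qed.

Fact in_ideal0 : 0 \in in_ideal.
Proof.
apply/in_idealP; exists 0%N, (fun=> 0), (fun=> 0).
by rewrite big_ord0.
Qed.

Fact in_idealD x y : x \in in_ideal -> y \in in_ideal -> x + y \in in_ideal.
Proof.
move=> /in_idealP[m [a [b ->]]] /in_idealP[n [c [d ->]]]; apply/in_idealP.
exists (m + n)%N, (fun i => match split i with inl i => a i | inr i => c i end),
  (fun i => match split i with inl i => b i | inr i => d i end).
rewrite big_split_ord /=; congr (_ + _); apply: eq_bigr => i _.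
  by rewrite (unsplitK (inl i)).
by rewrite (unsplitK (inr i)).
Qed.

Fact in_idealM u v x : x \in in_ideal -> u * x * v \in in_ideal.
Proof.
move=> /in_idealP[n [a [b ->]]]; apply/in_idealP.
exists n, (fun i => u * a i), (fun i => b i * v).
by rewrite mulr_sumr mulr_suml; apply: eq_bigr => i _; rewrite !mulrA.
Qed.

Fact in_idealMl u x : x \in in_ideal -> u * x \in in_ideal.
Proof. by move=> /(in_idealM u 1); rewrite mulr1. Qed.

Fact in_idealMr u x : x \in in_ideal -> x * u \in in_ideal.
Proof. by move=> /(in_idealM 1 u); rewrite mul1r. Qed.

Fact in_idealZ c x : x \in in_ideal -> c *: x \in in_ideal.
Proof. by move=> /(in_idealMl (c *: (1 : A))); rewrite -pascaleAl mul1r. Qed.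

Fact in_ideal_zmod_closed : zmod_closed in_ideal.
Proof.
split=> [|x y xI yI]; first exact: in_ideal0.
by apply: in_idealD => //; rewrite -mulN1r; exact: in_idealMl.
Qed.

HB.instance Definition _ :=
  GRing.isZmodClosed.Build A in_ideal in_ideal_zmod_closed.

Definition quot_alg := Quotient.quot in_ideal.
HB.instance Definition _ := GRing.Zmodule.on quot_alg.

Definition proj (x : A) : quot_alg := \pi_(Quotient.quot in_ideal)%qT x.

Fact projP x y : proj x = proj y <-> x - y \in in_ideal.
Proof. by rewrite Quotient.idealrBE; split=> [h|/eqP h]; first exact/eqP. Qed.

Fact proj_surj (u : quot_alg) : {x | proj x = u}.
Proof. by exists (repr u); rewrite /proj reprK. Qed.

Fact projD x y : proj (x + y) = proj x + proj y.
Proof. by rewrite /proj !piE. Qed.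

Definition qone : quot_alg := proj 1.
Definition qmul (u v : quot_alg) : quot_alg := proj (repr u * repr v).
Definition qscale (c : k) (u : quot_alg) : quot_alg := proj (c *: repr u).

Fact repr_proj x : repr (proj x) - x \in in_ideal.
Proof. by apply/projP; rewrite /proj reprK. Qed.

Fact qmul_proj x y : qmul (proj x) (proj y) = proj (x * y).
Proof.
apply/projP; set x' := repr _; set y' := repr _.
have -> : x' * y' - x * y = x' * (y' - y) + (x' - x) * y.
  by rewrite mulrBr mulrBl addrA subrK.
apply: in_idealD; [apply: in_idealMl | apply: in_idealMr]; exact: repr_proj.
Qed.

Fact qscale_proj c x : qscale c (proj x) = proj (c *: x).
Proof. by apply/projP; rewrite -scalerBr; apply: in_idealZ; exact: repr_proj. Qed.

Fact qmulA : associative qmul.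
Proof.
move=> u v w.
case: (proj_surj u) => x <-; case: (proj_surj v) => y <-.
case: (proj_surj w) => z <-.
by rewrite !qmul_proj mulrA.
Qed.
Fact qmul1l : left_id qone qmul.
Proof. by move=> u; case: (proj_surj u) => x <-; rewrite qmul_proj mul1r. Qed.
Fact qmul1r : right_id qone qmul.
Proof. by move=> u; case: (proj_surj u) => x <-; rewrite qmul_proj mulr1. Qed.
Fact qmulDl : left_distributive qmul +%R.
Proof.
move=> u v w.
case: (proj_surj u) => x <-; case: (proj_surj v) => y <-.
case: (proj_surj w) => z <-.
by rewrite -projD !qmul_proj mulrDl projD.
Qed.
Fact qmulDr : right_distributive qmul +%R.
Proof.
move=> u v w.
case: (proj_surj u) => x <-; case: (proj_surj v) => y <-.
case: (proj_surj w) => z <-.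
by rewrite -projD !qmul_proj mulrDr projD.
Qed.

HB.instance Definition _ := GRing.Zmodule_isPzRing.Build quot_alg
  qmulA qmul1l qmul1r qmulDl qmulDr.

Fact qscaleA c d u : qscale c (qscale d u) = qscale (c * d) u.
Proof. by case: (proj_surj u) => x <-; rewrite !qscale_proj scalerA. Qed.
Fact qscale1 : left_id 1 qscale.
Proof. by move=> u; case: (proj_surj u) => x <-; rewrite qscale_proj scale1r. Qed.
Fact qscaleDr : right_distributive qscale +%R.
Proof.
move=> c u v; case: (proj_surj u) => x <-; case: (proj_surj v) => y <-.
by rewrite -projD !qscale_proj scalerDr projD.
Qed.
Fact qscaleDl u : {morph qscale^~ u : c d / c + d}.
Proof.
by move=> c d; case: (proj_surj u) => x <-; rewrite !qscale_proj scalerDl projD.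
Qed.

HB.instance Definition _ := GRing.Zmodule_isLmodule.Build k quot_alg
  qscaleA qscale1 qscaleDr qscaleDl.

Fact projM x y : proj (x * y) = proj x * proj y.
Proof. by rewrite -qmul_proj. Qed.
Fact proj1 : proj 1 = 1. Proof. by []. Qed.
Fact projZ c x : proj (c *: x) = c *: proj x.
Proof. by rewrite -qscale_proj. Qed.

Fact quot_scaleAl c (u v : quot_alg) : c *: (u * v) = (c *: u) * v.
Proof.
case: (proj_surj u) => x <-; case: (proj_surj v) => y <-.
by rewrite -(projM x y) -!projZ -projM pascaleAl.
Qed.
Fact quot_scaleAr c (u v : quot_alg) : c *: (u * v) = u * (c *: v).
Proof.
case: (proj_surj u) => x <-; case: (proj_surj v) => y <-.
by rewrite -(projM x y) -!projZ -projM pascaleAr.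
Qed.
End QuotientAlgebra.

Section Preprojective.
Local Open Scope classical_set_scope.
Variables (k : fieldType) (G : graph).

(* The path i - j - i along a and back, where j is the other end of a; the    *)
(* sum over j has no term if i is not an end of a, and one term otherwise.    *)
Definition theta_at (i : vtx G) (a : edge G) : pathalg k G :=
  \sum_(j | ends a == [set i; j]%SET) path_elt k i [:: (a, j); (a, i)].

Definition theta : pathalg k G := \sum_i \sum_a theta_at i a.

Definition weight (lam : vtx G -> k) : pathalg k G := \sum_i lam i *: idp k i.

Definition preproj (lam : vtx G -> k) := quot_alg (theta - weight lam).

HB.instance Definition _ lam := GRing.PzRing.on (preproj lam).
HB.instance Definition _ lam := GRing.Lmodule.on (preproj lam).

Definition preproj_proj (lam : vtx G -> k) : pathalg k G -> preproj lam :=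
  @proj k G (theta - weight lam).

Definition commspan (lam : vtx G -> k) : set (preproj lam) :=
  span (@commutators (preproj lam)).

(* The image of the span of the paths of length zero.                         *)
Definition zero_paths (lam : vtx G -> k) : set (preproj lam) :=
  [set @preproj_proj lam x | x in span (range (@idp k G))].

Definition preproj_corner (lam : vtx G -> k) (i : vtx G) : set (preproj lam) :=
  corner (preproj_proj lam (idp k i)).
End Preprojective.
Arguments commspan {k G} lam _.
Arguments zero_paths {k G} lam _.
Arguments preproj_corner {k G} lam i _.

(* Main.v *)
From Stdlib Require Import Ncring Ncring_tac.
From HB Require Import structures.
From mathcomp Require Import all_boot all_order all_algebra.
From mathcomp Require Import finmap boolp classical_sets monalg.
From mathcomp Require Import zify.
Require Import Defs.

(** Why the theorem holds.  A path p from i to another vertex is the commutator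
    e_i p - p e_i, so only closed paths matter, and these may be rotated.  They
    are treated by induction on their length n.  Let S be the subspace on
    the right-hand side.  Send an element of kG to the class modulo S of the
    image in Pi^lambda of its part of length n.  This map kills commutators; it
    kills a * theta_i * b, because theta_i equals lambda_i e_i in Pi^lambda
    and what remains has length n - 2; in the affine case it also
    kills all paths through i0, because these can be rotated into the corner.
    It is therefore a trace on the undeformed preprojective algebra of a finite
    Dynkin graph: G itself, or G with i0 deleted ([quotient_trace_kernel]).
    So the statement is reduced to one about lambda = 0 and finite type: every
    trace vanishes on the closed paths of positive length, provided that its
    target has no torsion at the bad primes ([dynkin_closed_walk]).  In the affine case
    this uses that the characteristic is good for the smaller graph as well
    ([bad_prime_del_vertex]).

    A finite Dynkin graph is a star: up to three arms attached to a hub.  In the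
    undeformed algebra the relation at a vertex of an arm exchanges, up to sign,
    the loop towards the tip and the loop towards the hub.  Pushing loops to the
    tip makes the trace of a closed path inside an arm vanish, and pulling them
    to the hub turns a closed path through the hub into a word in the loops x,
    y, z that run along one edge of an arm and back ([star_closed_walk]).  The
    relation at the hub reads x + y + z = 0; the loop of an arm with l vertices
    has vanishing power l + 1, and all its powers have trace zero.

    What is left is algebra on two generators.  In all cases x * x = 0.
    - Type A: z = 0, so every word is a power of x up to sign.
    - Type D: z * z = 0, and the trace of (x + z)^(2 m) is twice that of
      (x z)^m ([words_type_D]).
    - Type E: y^3 = z^5 = 0 holds in E6, E7 and E8 alike.  Put u = x y and
      v = x y y.  The expansion of z^5 yields relations by which every word
      starting with x reduces to a short list of normal words, and each of these
      has trace zero after multiplication by 2, 3 or 5 ([words_type_E]).  The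
      factor 5 occurs for u v only, and z^4 = 0, valid in E6 and E7, replaces
      it by 2 there. *)

Set Implicit Arguments.
Unset Strict Implicit.
Unset Printing Implicit Defensive.

Import GRing.Theory.
Local Open Scope ring_scope.

(** * Subgroups containing the commutators *)

(** These instances make the decision procedure for identities in
    non-commutative rings available in abstract rings. *)
#[local] Instance pzRing_ops (A : pzRingType) :
  @Ring_ops A 0 1 +%R *%R (fun x y => x - y) -%R eq := {}.

#[local] Instance pzRing_ring (A : pzRingType) : Ring (Ro := pzRing_ops A).
Proof.
constructor; try exact _; try by move=> x _ <- // y _ <-.
- exact: add0r.
- exact: addrC.
- exact: addrA.
- exact: mul1r.
- exact: mulr1.
- exact: mulrA.
- exact: mulrDl.
- by move=> x y z; exact: mulrDr.
- by [].
- exact: subrr.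
Qed.

Ltac ncring := rewrite ?(exprSr, expr0, mul1r); non_commutative_ring.

(** Proves an equation by writing the difference of its two sides as a combination
    c of elements that vanish by H; the coefficients in c are what such a proof
    consists of. *)
Ltac from_relation c H :=
  apply/subr0_eq; transitivity c;
    [by ncring | by rewrite !H ?(mulr0, mul0r, oppr0, addr0, subr0)].

Inductive additive_span (A : zmodType) (P : A -> Prop) : A -> Prop :=
  | span_gen a : P a -> additive_span P a
  | span_0 : additive_span P 0
  | span_sub a b : additive_span P a -> additive_span P b -> additive_span P (a - b).

Section AdditiveSpan.
Variables (A : pzRingType) (P : A -> Prop).

Lemma spanN a : additive_span P a -> additive_span P (- a).
Proof. by move=> Pa; rewrite -sub0r; apply: span_sub => //; exact: span_0. Qed.

Lemma span_mulr c : (forall a, P a -> additive_span P (a * c)) ->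
  forall a, additive_span P a -> additive_span P (a * c).
Proof.
move=> Pc a; elim=> {a} [a /Pc //||a b _ IHa _ IHb].
- by rewrite mul0r; exact: span_0.
- by rewrite mulrBl; exact: span_sub.
Qed.
End AdditiveSpan.

(** A subgroup containing the commutators is the kernel of a trace, namely of the
    quotient map of abelian groups. *)
Record trace_kernel (A : pzRingType) (T : A -> Prop) : Prop := TraceKernel {
  tk0 : T 0;
  tkB : forall a b, T a -> T b -> T (a - b);
  tkC : forall a b, T (a * b - b * a)
}.

(** This says that the quotient of A by T has no n-torsion. *)
Definition torsion_free (A : pzRingType) (T : A -> Prop) (n : nat) : Prop :=
  forall a, T (a *+ n) -> T a.

Section TraceKernel.
Variables (A : pzRingType) (T : A -> Prop).
Hypothesis tkT : trace_kernel T.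

Lemma tkN a : T a -> T (- a).
Proof. by move=> Ta; rewrite -sub0r; apply: (tkB tkT) => //; exact: (tk0 tkT). Qed.

Lemma tkD a b : T a -> T b -> T (a + b).
Proof. by move=> Ta /tkN Tb; rewrite -[b]opprK; apply: (tkB tkT). Qed.

Lemma tk_rot a b : T (a * b) -> T (b * a).
Proof. by move=> Tab; have /(tkD Tab) := tkC tkT b a; rewrite addrC subrK. Qed.

Lemma tk_span (P : A -> Prop) : (forall a, P a -> T a) ->
  forall a, additive_span P a -> T a.
Proof.
move=> PT a; elim=> {a} [a /PT //||a b _ Ta _ Tb]; first exact: (tk0 tkT).
exact: (tkB tkT).
Qed.
End TraceKernel.

Inductive words (A : pzRingType) (P : A -> Prop) : A -> Prop :=
  | words_gen a : P a -> words P a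
  | words_mul a b : words P a -> P b -> words P (a * b)
  | words_opp a : words P a -> words P (- a).

Definition one_of3 (A : Type) (x y z a : A) : Prop := [\/ a = x, a = y | a = z].

Section ThreeLoops.
Variables (A : pzRingType) (T : A -> Prop).
Hypothesis tkT : trace_kernel T.

(** As z = - x - y, words in x and y suffice.  A word containing x is rotated so
    that x comes first; N is meant to be a set of normal forms for the words
    starting with x, stable under right multiplication.  The words y ^+ n * m
    with m in the span of N are those that wait to be rotated. *)
Lemma words_in_trace_kernel (x y z : A) (N : A -> Prop) :
  x + y + z = 0 -> (forall n, T (y ^+ n.+1)) ->
  N x -> (forall a, N a -> additive_span N (a * x)) ->
  (forall a, N a -> additive_span N (a * y)) -> (forall a, N a -> T a) ->
  forall a, words (one_of3 x y z) a -> T a.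
Proof.
move=> xyz Ty Nx Nmulx Nmuly NT.
pose M a := (exists n, a = y ^+ n.+1) \/
            (exists n m, additive_span N m /\ a = y ^+ n * m).
have Mx a : M a -> additive_span M (a * x).
  move=> [[n ->]|[n [m [Nm ->]]]]; apply: span_gen; right.
    by exists n.+1, x; split=> //; apply: span_gen.
  by exists n, (m * x); split; [exact: span_mulr | rewrite mulrA].
have My a : M a -> additive_span M (a * y).
  move=> [[n ->]|[n [m [Nm ->]]]]; apply: span_gen.
    by left; exists n.+1; rewrite -exprSr.
  by right; exists n, (m * y); split; [exact: span_mulr | rewrite mulrA].
have Nspan_pow n m : additive_span N m -> additive_span N (m * y ^+ n).
  elim: n m => [|n IH] m Nm; first by rewrite mulr1.
  by rewrite exprS mulrA; apply: IH; apply: span_mulr.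
have MT : forall a, additive_span M a -> T a.
  apply: tk_span => // a [[n ->] //|[n [m [Nm ->]]]].
  by apply: tk_rot => //; apply: (tk_span tkT NT); apply: Nspan_pow.
have Mx0 : additive_span M x.
  by apply: span_gen; right; exists 0%N, x; rewrite mul1r; split=> //; apply: span_gen.
have My0 : additive_span M y by apply: span_gen; left; exists 0%N.
have zE : z = - x - y by from_relation (x + y + z) xyz.
suff wM a : words (one_of3 x y z) a -> additive_span M a by move=> a /wM /MT.
elim=> {a} [a|a b _ Ma|a _ /spanN //].
  by case=> -> //; rewrite zE; apply: span_sub => //; apply: spanN.
have Max := span_mulr Mx Ma; have May := span_mulr My Ma.
by case=> -> //; rewrite zE mulrBr mulrN; apply: span_sub => //; apply: spanN.
Qed.

Lemma words_type_A (x y z : A) : x + y + z = 0 -> x * x = 0 -> z = 0 ->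
  (forall n, T (x ^+ n.+1)) -> (forall n, T (y ^+ n.+1)) ->
  forall a, words (one_of3 x y z) a -> T a.
Proof.
move=> xyz xx z0 Tx Ty.
have yE : y = - x by move: xyz; rewrite z0 => h; from_relation (x + y + 0) h.
apply: (@words_in_trace_kernel x y z (fun a => a = x)) => //.
- by move=> _ ->; rewrite xx; exact: span_0.
- by move=> _ ->; rewrite yE mulrN xx oppr0; exact: span_0.
- by move=> _ ->; exact: (Tx 0%N).
Qed.

(** Since x * x = z * z = 0, the normal words alternate x and z.  Those of odd
    length, except x, rotate to a word containing x * x; for the others the cross
    terms of (x z + z x) ^+ n vanish, so twice their trace is the trace of an even
    power of y. *)
Lemma words_type_D (x y z : A) : torsion_free T 2 ->
  x + y + z = 0 -> x * x = 0 -> z * z = 0 ->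
  (forall n, T (x ^+ n.+1)) -> (forall n, T (y ^+ n.+1)) ->
  (forall n, T (z ^+ n.+1)) ->
  forall a, words (one_of3 x y z) a -> T a.
Proof.
move=> tf2 xyz xx zz Tx Ty Tz.
suff main a : words (one_of3 x z y) a -> T a.
  move=> a wa; apply: main; elim: wa => {a} [a|a b _ IH|a _]; last exact: words_opp.
    by case=> ->; apply: words_gen; [apply: Or31|apply: Or33|apply: Or32].
  by move=> h; apply: words_mul => //; case: h => ->; [apply: Or31|apply: Or33|apply: Or32].
pose N a := exists n, a = (x * z) ^+ n * x \/ a = (x * z) ^+ n.+1.
have Ty2 n : (x + z) ^+ n.*2.+2 = (x * z) ^+ n.+1 + (z * x) ^+ n.+1.
  have sq : (x + z) ^+ 2 = x * z + z * x.
    by rewrite expr2 mulrDl !mulrDr xx zz add0r addr0.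
  rewrite -doubleS -muln2 mulnC exprM sq; elim: n => [|n IH]; first by rewrite !expr1.
  have xzzx : (x * z) ^+ n.+1 * (z * x) = 0.
    by rewrite exprSr -!mulrA (mulrA z z) zz mul0r !mulr0.
  have zxxz : (z * x) ^+ n.+1 * (x * z) = 0.
    by rewrite exprSr -!mulrA (mulrA x x) xx mul0r !mulr0.
  by rewrite exprSr IH mulrDr !mulrDl -!exprSr xzzx zxxz addr0 add0r.
apply: (@words_in_trace_kernel x z y N) => //.
- by rewrite -[RHS]xyz -!addrA [z + y]addrC.
- by exists 0%N; left; rewrite mul1r.
- move=> _ [n [->|->]]; first by rewrite -mulrA xx mulr0; exact: span_0.
  by apply: span_gen; exists n.+1; left.
- move=> _ [n [->|->]]; last by rewrite exprSr -!mulrA zz !mulr0; exact: span_0.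
  by apply: span_gen; exists n; right; rewrite exprSr mulrA.
- move=> _ [n [->|->]].
    apply: tk_rot => //; case: n => [|n]; first by rewrite mulr1; exact: (Tx 0%N).
    by rewrite exprS !mulrA xx !mul0r; exact: (tk0 tkT).
  apply: tf2; rewrite mulr2n.
  have -> : (x * z) ^+ n.+1 + (x * z) ^+ n.+1 = (y ^+ n.*2.+2)
        + ((x * z) ^+ n.+1 - (z * x) ^+ n.+1).
    have -> : y = - (x + z) by from_relation (x + y + z) xyz.
    by rewrite exprNn -doubleS -signr_odd odd_double mul1r doubleS Ty2; ncring.
  apply: tkD => //.
  rewrite exprSr; have -> : (z * x) ^+ n.+1 = z * ((x * z) ^+ n * x).
    by elim: n => [|n IH]; rewrite ?mul1r // exprSr IH exprSr !mulrA.
  by rewrite mulrA; apply: (tkC tkT).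
Qed.
End ThreeLoops.

(** * Loops of type E: relations *)

Section TypeE.
Variables (A : pzRingType) (T : A -> Prop) (x y z : A).
Hypothesis tkT : trace_kernel T.
Hypotheses (tf2 : torsion_free T 2) (tf3 : torsion_free T 3).
Hypotheses (xyz : x + y + z = 0) (xx : x * x = 0) (yyy : y * y * y = 0).
Hypothesis z5 : z ^+ 5 = 0.
Hypothesis tf5_or_z4 : torsion_free T 5 \/ z ^+ 4 = 0.
Hypotheses (Tx : T x) (Ty : forall n, T (y ^+ n.+1)) (Tz : forall n, T (z ^+ n.+1)).

Local Notation s := (x + y).
Local Notation u := (x * y).
Local Notation v := (x * y * y).

Lemma typeE_s n : s ^+ n = (-1) ^+ n * z ^+ n.
Proof.
have -> : s = - z by from_relation (x + y + z) xyz.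
exact: exprNn.
Qed.

Let zero_words := (xx, yyy).

Lemma typeE_xs4 : x * s ^+ 4 = u * u * x + u * v + v * u.
Proof.
by from_relation (x * x * s ^+ 3 + u * (x * x) * s + v * (x * x)
  + x * (y * y * y) * s) zero_words.
Qed.

(** This is x * s ^+ 5 = 0 with the vanishing words removed.  All relations below
    follow from this one and [typeE_relation_v]. *)
Lemma typeE_relation_x : u * u * u + u * v * x + v * u * x + v * v = 0.
Proof.
transitivity (x * s ^+ 5); last by rewrite typeE_s z5 !mulr0.
apply/esym; rewrite exprSr mulrA typeE_xs4.
by from_relation (u * u * (x * x) + u * x * (y * y * y)) zero_words.
Qed.

Lemma typeE_relation_v : v * u * u * x + v * u * v + v * v * u = 0.
Proof.
transitivity (v * s ^+ 5); last by rewrite typeE_s z5 !mulr0.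
transitivity (v * (x * s ^+ 4) + x * (y * y * y) * s ^+ 4); last by ncring.
by rewrite typeE_xs4 yyy mulr0 mul0r addr0; ncring.
Qed.

Let relations0 := (typeE_relation_x, typeE_relation_v, xx, yyy).

Lemma typeE_vvu : v * v * u + u ^+ 4 = 0.
Proof.
by from_relation ((u * u * u + u * v * x + v * u * x + v * v) * x * y
  - (u * v + v * u) * (x * x) * y) relations0.
Qed.

Lemma typeE_vvv : v * v * v + u ^+ 3 * v = 0.
Proof.
by from_relation ((u * u * u + u * v * x + v * u * x + v * v) * x * y * y
  - (u * v + v * u) * (x * x) * y * y) relations0.
Qed.

Lemma typeE_uuv : u * u * v + u * v * u + v * u * u = 0.
Proof.
by from_relation ((u * u * u + u * v * x + v * u * x + v * v) * y
  - v * x * (y * y * y)) relations0.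
Qed.

Lemma typeE_uvv : u * v * v + v * u * v = 0.
Proof.
by from_relation ((u * u * v + u * v * u + v * u * u) * y
  - u * u * x * (y * y * y)) (typeE_uuv, yyy).
Qed.

Lemma typeE_vuuu : v * u ^+ 3 + v * v * v = 0.
Proof.
by from_relation ((v * u * u * x + v * u * v + v * v * u) * y
  - v * u * x * (y * y * y)) relations0.
Qed.

Lemma typeE_vuuv : v * u * u * v = 0.
Proof.
by from_relation ((v * u ^+ 3 + v * v * v) * y - v * v * x * (y * y * y))
  (typeE_vuuu, yyy).
Qed.

Lemma typeE_uuuv : u ^+ 3 * v - v * u ^+ 3 = 0.
Proof.
by from_relation ((v * v * v + u ^+ 3 * v) - (v * u ^+ 3 + v * v * v))
  (typeE_vvv, typeE_vuuu).
Qed.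

Lemma typeE_vuvu : v * u * v * u - u ^+ 5 = 0.
Proof.
by from_relation (v * (u * u * v + u * v * u + v * u * u) - v * u * u * v
  - (v * v * u + u ^+ 4) * u) (typeE_uuv, typeE_vuuv, typeE_vvu).
Qed.

Lemma typeE_u5v : u ^+ 5 * v = 0.
Proof.
by from_relation ((v * v * u + u ^+ 4) * u * v - v * (v * u * u * v))
  (typeE_vvu, typeE_vuuv).
Qed.

Lemma typeE_vuuuv : v * u ^+ 3 * v + u ^+ 6 = 0.
Proof.
by from_relation (v * (u ^+ 3 * v - v * u ^+ 3) + (v * v * u + u ^+ 4) * u * u)
  (typeE_uuuv, typeE_vvu).
Qed.

Lemma typeE_vu4v : v * u ^+ 4 * v - u ^+ 7 = 0.
Proof.
by from_relation (v * u * (u ^+ 3 * v - v * u ^+ 3)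
  + (v * u * v * u - u ^+ 5) * u * u) (typeE_uuuv, typeE_vuvu).
Qed.

Lemma typeE_u9 : u ^+ 9 = 0.
Proof.
by from_relation ((v * v * u + u ^+ 4) * u ^+ 5
  + v * (u ^+ 3 * v - v * u ^+ 3) * u ^+ 3
  + v * u ^+ 3 * (u ^+ 3 * v - v * u ^+ 3) - v * u * (u ^+ 5 * v))
  (typeE_vvu, typeE_uuuv, typeE_u5v).
Qed.

(** * Loops of type E: normal words *)

(** Every word starting with x is an integral combination of x, of these words, and
    of their products with x on the right. *)
Inductive typeE_normal : A -> Prop :=
  | normal_u j : typeE_normal (u ^+ j.+1)
  | normal_vu j : typeE_normal (v * u ^+ j)
  | normal_uvu j : typeE_normal (u * v * u ^+ j)
  | normal_vuv : typeE_normal (v * u * v)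
  | normal_uvuv : typeE_normal (u * v * u * v)
  | normal_vv : typeE_normal (v * v).

Let nspan := additive_span typeE_normal.

Lemma nspan_u j : nspan (u ^+ j.+1). Proof. by apply: span_gen; constructor. Qed.
Lemma nspan_vu j : nspan (v * u ^+ j). Proof. by apply: span_gen; constructor. Qed.
Lemma nspan_uvu j : nspan (u * v * u ^+ j).
Proof. by apply: span_gen; constructor. Qed.

Lemma typeE_normal_u a : typeE_normal a -> nspan (a * u).
Proof.
case=> [j|j|j|||].
- by rewrite -exprSr; exact: nspan_u.
- by rewrite -mulrA -exprSr; exact: nspan_vu.
- by rewrite -mulrA -exprSr; exact: nspan_uvu.
- have -> : v * u * v * u = u ^+ 5 by from_relation (v * u * v * u - u ^+ 5) typeE_vuvu.
  exact: nspan_u.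
- have -> : u * v * u * v * u = u ^+ 6.
    by from_relation (u * (v * u * v * u - u ^+ 5)) typeE_vuvu.
  exact: nspan_u.
- have -> : v * v * u = - u ^+ 4 by from_relation (v * v * u + u ^+ 4) typeE_vvu.
  by apply: spanN; exact: nspan_u.
Qed.

Lemma nspan_uv j : nspan (u ^+ j * v).
Proof.
case: j => [|[|[|[|[|j]]]]].
- have -> : u ^+ 0 * v = v * u ^+ 0 by ncring.
  exact: nspan_vu.
- have -> : u ^+ 1 * v = u * v * u ^+ 0 by ncring.
  exact: nspan_uvu.
- have -> : u ^+ 2 * v = - (u * v * u ^+ 1) - v * u ^+ 2.
    by from_relation (u * u * v + u * v * u + v * u * u) typeE_uuv.
  by apply: span_sub; [apply: spanN; exact: nspan_uvu | exact: nspan_vu].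
- have -> : u ^+ 3 * v = v * u ^+ 3.
    by from_relation (u ^+ 3 * v - v * u ^+ 3) typeE_uuuv.
  exact: nspan_vu.
- have -> : u ^+ 4 * v = u * v * u ^+ 3.
    by from_relation (u * (u ^+ 3 * v - v * u ^+ 3)) typeE_uuuv.
  exact: nspan_uvu.
- have -> : u ^+ j.+1.+4 * v = 0.
    by from_relation (u ^+ j * (u ^+ 5 * v)) typeE_u5v.
  exact: span_0.
Qed.

Lemma nspan_vuv j : nspan (v * u ^+ j * v).
Proof.
case: j => [|[|[|[|[|j]]]]].
- by rewrite mulr1; apply: span_gen; constructor.
- by apply: span_gen; constructor.
- have -> : v * u ^+ 2 * v = 0 by from_relation (v * u * u * v) typeE_vuuv.
  exact: span_0.
- have -> : v * u ^+ 3 * v = - u ^+ 6.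
    by from_relation (v * u ^+ 3 * v + u ^+ 6) typeE_vuuuv.
  by apply: spanN; exact: nspan_u.
- have -> : v * u ^+ 4 * v = u ^+ 7.
    by from_relation (v * u ^+ 4 * v - u ^+ 7) typeE_vu4v.
  exact: nspan_u.
- have -> : v * u ^+ j.+1.+4 * v = 0.
    by from_relation (v * u ^+ j * (u ^+ 5 * v)) typeE_u5v.
  exact: span_0.
Qed.

Lemma nspan_uvuv j : nspan (u * v * u ^+ j * v).
Proof.
case: j => [|[|[|[|[|j]]]]].
- have -> : u * v * u ^+ 0 * v = - (v * u * v).
    by from_relation (u * v * v + v * u * v) typeE_uvv.
  by apply: spanN; apply: span_gen; constructor.
- by apply: span_gen; constructor.
- have -> : u * v * u ^+ 2 * v = 0.
    by from_relation (u * (v * u * u * v)) typeE_vuuv.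
  exact: span_0.
- have -> : u * v * u ^+ 3 * v = - u ^+ 7.
    by from_relation (u * (v * u ^+ 3 * v + u ^+ 6)) typeE_vuuuv.
  by apply: spanN; exact: nspan_u.
- have -> : u * v * u ^+ 4 * v = u ^+ 8.
    by from_relation (u * (v * u ^+ 4 * v - u ^+ 7)) typeE_vu4v.
  exact: nspan_u.
- have -> : u * v * u ^+ j.+1.+4 * v = 0.
    by from_relation (u * v * u ^+ j * (u ^+ 5 * v)) typeE_u5v.
  exact: span_0.
Qed.

Lemma typeE_normal_y a : typeE_normal a -> nspan (a * y).
Proof.
have vy w : w * v * y = 0 by rewrite -!mulrA (mulrA y y) yyy !mulr0.
case=> [j|[|j]|[|j]|||]; try by rewrite ?mulr1 ?vy; exact: span_0.
- have -> : u ^+ j.+1 * y = u ^+ j * v by ncring.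
  exact: nspan_uv.
- by rewrite mulr1 -[v]mul1r vy; exact: span_0.
- have -> : v * u ^+ j.+1 * y = v * u ^+ j * v by ncring.
  exact: nspan_vuv.
- have -> : u * v * u ^+ j.+1 * y = u * v * u ^+ j * v by ncring.
  exact: nspan_uvuv.
Qed.

(** * Loops of type E: traces *)

Let T0 := tk0 tkT.
Let TD := tkD tkT.
Let TB := tkB tkT.
Let TN := tkN tkT.
Let TC := tkC tkT.
Let Trot := tk_rot tkT.

Lemma typeE_T_x a : T (x * a * x).
Proof. by apply: Trot; rewrite mulrA xx mul0r. Qed.

Lemma typeE_T_s n : T (s ^+ n.+1).
Proof.
rewrite typeE_s -signr_odd; case: (odd _); rewrite ?mulN1r ?mul1r //.
exact: TN.
Qed.

(** Powers of z have trace zero.  Split s ^+ m.+3 according to the position of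
    the first factor x, which is preceded by at most two factors y because
    y * y * y = 0, and rotate this factor to the front. *)
Lemma typeE_T_power m :
  T (x * s ^+ m.+2 + x * s ^+ m.+1 * y + x * s ^+ m * y * y).
Proof.
have -> : x * s ^+ m.+2 + x * s ^+ m.+1 * y + x * s ^+ m * y * y =
    s ^+ m.+3 - y * y * y * s ^+ m
    + ((x * s ^+ m.+1) * y - y * (x * s ^+ m.+1))
    + ((x * s ^+ m) * (y * y) - (y * y) * (x * s ^+ m)).
  have := (exprS s m.+2, exprS s m.+1, exprS s m).
  move: (s ^+ m.+3) (s ^+ m.+2) (s ^+ m.+1) (s ^+ m) => p3 p2 p1 p0 [[-> p2E] p1E].
  have p2z : p2 - s * p1 = 0 by rewrite -p2E subrr.
  have p1z : p1 - s * p0 = 0 by rewrite -p1E subrr.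
  by from_relation (- (y * (p2 - s * p1)) - y * y * (p1 - s * p0)) (p2z, p1z).
rewrite yyy mul0r subr0.
by do 2?[apply: TD; last exact: TC]; exact: typeE_T_s.
Qed.

Lemma typeE_T_u : T u.
Proof.
apply: tf2.
have -> : u *+ 2 = s ^+ 2 - y ^+ 2 + (x * y - y * x).
  by rewrite mulr2n; from_relation (- (x * x)) xx.
by apply: TD; [apply: TB; [exact: typeE_T_s | exact: Ty] | exact: TC].
Qed.

Lemma typeE_T_v : T v.
Proof.
apply: tf3.
have -> : v *+ 3 = (x * s ^+ 2 + x * s ^+ 1 * y + x * s ^+ 0 * y * y) - x * y * x.
  by rewrite !mulrS mulr0n; from_relation (- (x * x * s) - x * x * y) xx.
by apply: TB; [exact: typeE_T_power | exact: typeE_T_x].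
Qed.

Lemma typeE_T_uu : T (u * u).
Proof.
apply: tf2.
have -> : u * u *+ 2 = (x * s ^+ 3 + x * s ^+ 2 * y + x * s ^+ 1 * y * y) - x * (y * y) * x.
  rewrite mulr2n.
  from_relation (- (x * x) * (s ^+ 2) - x * y * (x * x) - x * (y * y * y) - x * x * s * y
    - x * (y * y * y) - x * x * y * y - x * (y * y * y)) (xx, yyy).
by apply: TB; [exact: typeE_T_power | exact: typeE_T_x].
Qed.

(** The one place where E8 differs from E6 and E7: the fifth power of z gives 5
    times the trace of u v, the fourth one gives twice this trace. *)
Lemma typeE_T_uv : T (u * v).
Proof.
have Tuux : T (u * u * x) by rewrite -(mulrA x y); exact: typeE_T_x.
case: tf5_or_z4 => [tf5|z4].
  apply: tf5.
  have -> : u * v *+ 5 = (x * s ^+ 4 + x * s ^+ 3 * y + x * s ^+ 2 * y * y)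
      - u * u * x + (u * v - v * u) + (u * v - v * u).
    rewrite typeE_xs4 !mulrS mulr0n.
    from_relation (- (x * x * s ^+ 2 * y) - x * y * (x * x) * y - x * (y * y * y) * y
       - x * x * s * y * y - x * (y * y * y) * y) (xx, yyy).
  do 2![apply: TD; last exact: TC].
  by apply: TB => //; exact: typeE_T_power.
apply: tf2.
have xs4 : x * s ^+ 4 = 0 by rewrite typeE_s z4 !mulr0.
have -> : u * v *+ 2 = u * u * x + u * v + v * u - u * u * x + (u * v - v * u).
  by rewrite mulr2n; ncring.
by rewrite -typeE_xs4 xs4 sub0r; apply: TD; [exact: TN | exact: TC].
Qed.

Lemma typeE_T_uuu_vv : T (u ^+ 3) /\ T (v * v).
Proof.
have T1 : T (u ^+ 3 + v * v).
  have -> : u ^+ 3 + v * v = - (x * (y * v) * x) - (x * (y * y * u) * x).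
    by from_relation (u * u * u + u * v * x + v * u * x + v * v) typeE_relation_x.
  by apply: TB; [apply: TN |]; exact: typeE_T_x.
suff Tvv : T (v * v) by split=> //; rewrite -[u ^+ 3](addrK (v * v)); apply: TB.
have -> : v * v = (x * s ^+ 5 + x * s ^+ 4 * y + x * s ^+ 3 * y * y) - (u ^+ 3 + v * v).
  rewrite typeE_xs4 [in x * s ^+ 5]typeE_s z5 !mulr0 add0r.
  from_relation (- (x * x * s ^+ 2 * y * y) - u * (x * x) * y * y - x * (y * y * y) * y * y
    - u * x * (y * y * y) - u * x * (y * y * y) * 1) (xx, yyy).
by apply: TB => //; exact: typeE_T_power.
Qed.

Local Notation comm a b := (a * b - b * a).

Lemma typeE_T_uuv : T (u * u * v).
Proof.
apply: tf3.
have -> : u * u * v *+ 3 = comm u (u * v) + comm u (u * v) + comm u (v * u).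
  by rewrite !mulrS mulr0n; from_relation (u * u * v + u * v * u + v * u * u) typeE_uuv.
by do 2![apply: TD; last exact: TC]; exact: TC.
Qed.

Lemma typeE_T_uvv : T (u * v * v).
Proof.
apply: tf2.
have -> : u * v * v *+ 2 = comm (u * v) v.
  by rewrite !mulrS mulr0n; from_relation (u * v * v + v * u * v) typeE_uvv.
exact: TC.
Qed.

Lemma typeE_T_vu3 : T (v * u ^+ 3).
Proof.
apply: tf3.
have -> : v * u ^+ 3 *+ 3 = comm (v * u) (u * u) + comm (v * u * u) u.
  rewrite !mulrS mulr0n.
  by from_relation ((u * u * v + u * v * u + v * u * u) * u) typeE_uuv.
by apply: TD; exact: TC.
Qed.

Lemma typeE_T_uv3 : T (u * v ^+ 3).
Proof.
apply: tf2.
have -> : u * v ^+ 3 *+ 2 = comm (u * v * v) v.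
  by rewrite !mulrS mulr0n; from_relation ((u * v * v + v * u * v) * v) typeE_uvv.
exact: TC.
Qed.

Lemma typeE_T_uv4 : T (u * v ^+ 4).
Proof.
apply: tf2.
have -> : u * v ^+ 4 *+ 2 = comm (u * v ^+ 3) v.
  by rewrite !mulrS mulr0n; from_relation ((u * v * v + v * u * v) * v * v) typeE_uvv.
exact: TC.
Qed.

Lemma typeE_T_upow j : T (u ^+ j.+1).
Proof.
case: j => [|[|[|[|[|[|[|[|j]]]]]]]].
- exact: typeE_T_u.
- exact: typeE_T_uu.
- by have [] := typeE_T_uuu_vv.
- have -> : u ^+ 4 = comm u (v * v) - u * v * v.
    by from_relation (v * v * u + u ^+ 4) typeE_vvu.
  by apply: TB; [exact: TC | exact: typeE_T_uvv].
- have -> : u ^+ 5 = comm (v * u * u) v.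
    by from_relation ((v * v * u + u ^+ 4) * u - v * u * u * v) (typeE_vvu, typeE_vuuv).
  exact: TC.
- have -> : u ^+ 6 = comm (u * v) (u * v * u).
    by from_relation (u * (v * u * u * v) - u * (v * u * v * u - u ^+ 5))
      (typeE_vuvu, typeE_vuuv).
  exact: TC.
- have -> : u ^+ 7 = u * v ^+ 4 - comm u (v ^+ 4).
    by from_relation ((v * v * u + u ^+ 4) * u ^+ 3 - v * v * (v * v * u + u ^+ 4))
      typeE_vvu.
  by apply: TB; [exact: typeE_T_uv4 | exact: TC].
- have -> : u ^+ 8 = comm v (v ^+ 3 * u * u).
    by from_relation ((v * v * u + u ^+ 4) * u ^+ 4 - v * v * (v * v * u + u ^+ 4) * u
      + v * v * (v * u * u * v)) (typeE_vvu, typeE_vuuv).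
  exact: TC.
- have -> : u ^+ j.+1.+4.+4 = 0 by from_relation (u ^+ j * u ^+ 9) typeE_u9.
  exact: T0.
Qed.

Lemma typeE_T_vupow j : T (v * u ^+ j).
Proof.
case: j => [|[|[|[|[|j]]]]].
- by rewrite mulr1; exact: typeE_T_v.
- by apply: Trot; exact: typeE_T_uv.
- by apply: Trot; exact: typeE_T_uuv.
- exact: typeE_T_vu3.
- have -> : v * u ^+ 4 = comm v (u ^+ 4) - u * v ^+ 3.
    by from_relation (u * (v * v * v + u ^+ 3 * v)) typeE_vvv.
  by apply: TB; [exact: TC | exact: typeE_T_uv3].
- apply: Trot; have -> : u ^+ j.+1.+4 * v = 0.
    by from_relation (u ^+ j * (u ^+ 5 * v)) typeE_u5v.
  exact: T0.
Qed.

Lemma typeE_T_normal a : typeE_normal a -> T a.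
Proof.
case=> [j|j|j|||]; first exact: typeE_T_upow; first exact: typeE_T_vupow.
- by rewrite -mulrA; apply: Trot; rewrite -mulrA -exprSr; exact: typeE_T_vupow.
- by rewrite -mulrA; apply: Trot; exact: typeE_T_uvv.
- have -> : u * v * u * v = comm v (u * u * v).
    by from_relation (u * (u * v * v + v * u * v) - v * u * u * v) (typeE_uvv, typeE_vuuv).
  exact: TC.
- by have [] := typeE_T_uuu_vv.
Qed.

Lemma typeE_normal_x a : typeE_normal a -> exists b, a = x * b.
Proof.
case=> [j|j|j|||]; [exists (y * u ^+ j)|exists (y * y * u ^+ j)|exists (y * v * u ^+ j)
  |exists (y * y * u * v)|exists (y * v * u * v)|exists (y * y * v)];
  by rewrite ?exprS !mulrA.
Qed.

Lemma words_type_E a : words (one_of3 x y z) a -> T a.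
Proof.
pose N a := [\/ a = x, typeE_normal a | exists2 n, typeE_normal n & a = n * x].
have nspanN a' : nspan a' -> additive_span N a'.
  elim=> {a'} [a' na||a' b _ Na _ Nb]; last exact: span_sub.
    by apply: span_gen; apply: Or32.
  exact: span_0.
move: a; apply: (@words_in_trace_kernel _ T tkT x y z N) => //.
- exact: Or31.
- move=> a [->|nn|[n nn ->]].
  + by rewrite xx; exact: span_0.
  + by apply: span_gen; apply: Or33; exists a.
  + by rewrite -mulrA xx mulr0; exact: span_0.
- move=> a [->|nn|[n nn ->]]; apply: nspanN.
  + exact: (nspan_u 0).
  + exact: typeE_normal_y.
  + by rewrite -mulrA; exact: typeE_normal_u.
- move=> a [->|nn|[n nn ->]] //; first exact: typeE_T_normal.
  by have [b ->] := typeE_normal_x nn; exact: typeE_T_x.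
Qed.
End TypeE.

(** * Arms *)

Section Arm.
Variables (A : pzRingType) (T : A -> Prop) (up dn : nat -> A) (len : nat).

(** An arm has vertices 0 (its tip), ..., len, the last one being the hub; [up i]
    and [dn i] are the two directions of the edge between i and i.+1.  The loop
    at h goes one step towards the tip and back, hence vanishes at the tip.
    With this convention the relation at each vertex other than the hub takes
    the same form [arm_loop i + up i * dn i = 0]. *)
Definition arm_loop (h : nat) : A := if h is h'.+1 then dn h' * up h' else 0.

Fixpoint descent (h k : nat) : A :=
  if k is k'.+1 then descent h k' * dn (h - k'.+1)%N else 1.

Hypothesis arm_rel : forall i, (i < len)%N -> arm_loop i + up i * dn i = 0.

(** Turning back after k.+1 steps down is the same, up to sign, as making one
    loop at h before descending k steps: the relations along the arm carry the
    loop upwards. *)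
Lemma descent_up h k : (k < h)%N -> (h <= len)%N ->
  descent h k.+1 * up (h - k.+1)%N = (-1) ^+ k * (arm_loop h * descent h k).
Proof.
move=> + hl; elim: k => [|k IH] kh.
  by rewrite /= !mul1r mulr1 subn1; case: h hl kh.
have hk : (h - k.+1 = (h - k.+2).+1)%N by rewrite -subSn.
rewrite [descent _ k.+2]/= -mulrA.
have /addr0_eq : arm_loop (h - k.+1) + up (h - k.+1)%N * dn (h - k.+1)%N = 0.
  by apply: arm_rel; rewrite (leq_trans _ hl) // ltn_subrL (leq_trans _ kh).
rewrite [in arm_loop _]hk [arm_loop _.+1]/= => /(canRL (@opprK _)) ->.
by rewrite mulrN mulrA IH 1?ltnW // exprS !mulrA mulN1r !mulNr.
Qed.

Lemma arm_loop_descent h k : (k < h)%N -> (h <= len)%N ->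
  arm_loop h * descent h k = (-1) ^+ k * (descent h k.+1 * up (h - k.+1)%N).
Proof.
by move=> kh hl; rewrite descent_up // mulrA -exprD addnn -signr_odd odd_double mul1r.
Qed.

(** Each loop at h can be traded for one more step down, and below the tip there
    is nothing. *)
Lemma arm_loop_pow_descent h j k : (h <= len)%N -> (j + k)%N = h ->
  arm_loop h ^+ j.+1 * descent h k = 0.
Proof.
move=> hl; elim: j k => [|j IH] k jk.
  rewrite add0n in jk; rewrite jk expr1 {k jk}; case: h hl => [|h] hl.
    exact: mul0r.
  rewrite [descent _ _]/= subnn mulrA arm_loop_descent // subnn.
  have := arm_rel (leq_trans (ltn0Sn h) hl); rewrite /= add0r => u0.
  by rewrite -!mulrA u0 !mulr0.
have kh : (k < h)%N by rewrite -jk addSn ltnS leq_addl.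
rewrite exprSr -mulrA arm_loop_descent // mulrA commr_sign -mulrA.
by rewrite (mulrA (arm_loop h ^+ _)) (IH k.+1) -?addSnnS // mul0r mulr0.
Qed.

Lemma arm_loop_nilpotent h : (h <= len)%N -> arm_loop h ^+ h.+1 = 0.
Proof. by move=> hl; have := @arm_loop_pow_descent h h 0 hl (addn0 h); rewrite mulr1. Qed.

Hypothesis tkT : trace_kernel T.

(** Rotating and using the relation moves a power of the loop one vertex closer
    to the tip, where it vanishes. *)
Lemma arm_loop_pow_trace h n : (h <= len)%N -> T (arm_loop h ^+ n.+1).
Proof.
elim: h => [|h IH] hl; first by rewrite expr0n; exact: (tk0 tkT).
have rot : (dn h * up h) ^+ n.+1 = dn h * ((up h * dn h) ^+ n * up h).
  by elim: n {IH} => [|m IHm]; rewrite ?mul1r // exprSr IHm exprSr !mulrA.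
rewrite [arm_loop _]/= rot; apply: (tk_rot tkT); rewrite -mulrA -exprSr.
have /addr0_eq <- := arm_rel hl.
rewrite exprNn -signr_odd; have := IH (ltnW hl).
by case: (odd _); rewrite ?mul1r ?mulN1r //; exact: (tkN tkT).
Qed.
End Arm.

Section WalkProduct.
Variables (A : pzRingType) (T : A -> Prop) (V : eqType) (beta : V -> V -> A).

Fixpoint walk_prod (i : V) (s : seq V) : A :=
  if s is j :: s' then beta i j * walk_prod j s' else 1.

Lemma walk_prod_cat i s t :
  walk_prod i (s ++ t) = walk_prod i s * walk_prod (last i s) t.
Proof. by elim: s i => [|j s IH] i /=; rewrite ?mul1r // IH mulrA. Qed.

Lemma walk_prod_rcons i s j : walk_prod i (rcons s j) = walk_prod i s * beta (last i s) j.
Proof. by rewrite -cats1 walk_prod_cat /= mulr1. Qed.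

Lemma rotate_closed_walk (e : rel V) i s j : trace_kernel T ->
  path e i s -> last i s = i -> j \in s ->
  exists s', [/\ path e j s', last j s' = j, s' =i s &
                 T (walk_prod j s') -> T (walk_prod i s)].
Proof.
move=> tkT + + js; case/path.splitP: js => s1 s2.
rewrite cat_path last_cat !last_rcons => /andP[es1 es2] ls2.
exists (s2 ++ rcons s1 j); split.
- by rewrite cat_path es2 ls2.
- by rewrite last_cat last_rcons.
- by move=> q; rewrite !mem_cat orbC.
- rewrite !walk_prod_cat last_rcons ls2; exact: (tk_rot tkT).
Qed.
End WalkProduct.

Section Star.
Variables (A : pzRingType) (T : A -> Prop).
Variables (V : eqType) (beta : V -> V -> A) (e : rel V).
Variables (c : V) (I : Type) (len : I -> nat) (vx : I -> nat -> V).

Definition arm_up r i := beta (vx r i) (vx r i.+1).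
Definition arm_dn r i := beta (vx r i.+1) (vx r i).
Definition hub_loop r := arm_loop (arm_up r) (arm_dn r) (len r).
Local Notation loop r := (arm_loop (arm_up r) (arm_dn r)).
Local Notation desc r := (descent (arm_dn r)).

Hypothesis vx_len : forall r, vx r (len r) = c.
Hypothesis star_rel : forall r i, (i < len r)%N -> loop r i + arm_up r i * arm_dn r i = 0.

Definition hub_word (a : A) : Prop := words (fun b => exists r, b = hub_loop r) a.

(** At each vertex of an arm the product of a walk from the hub has the form
    (word in the loops at the hub) * (straight descent); a step up again turns
    the last step of the descent into a factor of the word, by [descent_up].
    The set D confines the walk, which permits to treat an inner vertex of an
    arm as the hub of a shorter star with one arm. *)
Lemma walk_from_hub (D : pred V) s :
  (forall r i q, (i < len r)%N -> D q -> e (vx r i) q ->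
     q = vx r i.+1 \/ exists2 j, i = j.+1 & q = vx r j) ->
  (forall q, D q -> e c q -> exists r j, len r = j.+1 /\ q = vx r j) ->
  path e c s -> all D s -> s <> [::] ->
  (last c s = c /\ hub_word (walk_prod beta c s)) \/
  exists r k w, [/\ (k < len r)%N, last c s = vx r (len r - k.+1)%N,
    w = 1 \/ hub_word w & walk_prod beta c s = w * desc r (len r) k.+1].
Proof.
move=> arm_nbr hub_nbr; elim/last_ind: s => // s q IH.
rewrite rcons_path all_rcons last_rcons walk_prod_rcons => /andP[es eq] /andP[Dq Ds] _.
have leave_hub w : w = 1 \/ hub_word w -> last c s = c -> walk_prod beta c s = w ->
    exists r k w, [/\ (k < len r)%N, q = vx r (len r - k.+1)%N,
    w = 1 \/ hub_word w & walk_prod beta c s * beta (last c s) q = w * desc r (len r) k.+1].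
  move=> ww lc ->; rewrite lc in eq *; have [r [j [lr ->]]] := hub_nbr _ Dq eq.
  exists r, 0%N, w; rewrite /= mul1r lr subn1 /=; split=> //.
  by rewrite /arm_dn -lr vx_len.
have [s0|/eqP sn0] := altP (s =P [::]).
  by right; apply: (leave_hub 1); [left | rewrite s0 | rewrite s0].
have {IH}[[lc ws]|[r [k [w [kl lk ww wE]]]]] := IH es Ds sn0.
  by right; apply: (leave_hub (walk_prod beta c s)) => //; right.
rewrite {}wE {leave_hub}; rewrite {}lk in eq *.
have il : (len r - k.+1 < len r)%N by rewrite ltn_subrL (leq_trans _ kl).
have [qE|[j jE qE]] := arm_nbr r _ q il Dq eq; last first.
  have kj : (k.+1 < len r)%N by rewrite -subn_gt0 jE.
  have jE' : (len r - k.+2 = j)%N by rewrite subnS jE.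
  right; exists r, k.+1, w; split=> //; first by rewrite jE'.
  by rewrite qE jE -mulrA [desc r _ k.+2]/= jE'.
have hE : (len r - k.+1).+1 = (len r - k)%N by rewrite -subSn.
have wloop : hub_word ((-1) ^+ k * (w * hub_loop r)).
  have wl : hub_word (w * hub_loop r).
    case: ww => [->|ww]; first by rewrite mul1r; apply: words_gen; exists r.
    by apply: words_mul => //; exists r.
  by rewrite -signr_odd; case: (odd k); rewrite ?mul1r // mulN1r; apply: words_opp.
have stepE : w * desc r (len r) k.+1 * beta (vx r (len r - k.+1)%N) q
    = (-1) ^+ k * (w * hub_loop r) * desc r (len r) k.
  rewrite qE -mulrA (@descent_up _ (arm_up r) _ (len r) (star_rel (r:=r))) //.
  by rewrite mulrA commr_sign -!mulrA.
case: k => [|k] in kl il eq qE hE wloop stepE *.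
  left; split; first by rewrite qE hE subn0 vx_len.
  by rewrite stepE mulr1.
right; exists r, k, ((-1) ^+ k.+1 * (w * hub_loop r)).
by split=> //; [exact: ltnW | rewrite qE hE | right].
Qed.
End Star.

Section StarClosedWalks.
Variables (A : pzRingType) (T : A -> Prop).
Variables (V : eqType) (beta : V -> V -> A) (e : rel V).
Variables (c : V) (I : Type) (len : I -> nat) (vx : I -> nat -> V).
Hypothesis tkT : trace_kernel T.
Hypothesis vx_len : forall r, vx r (len r) = c.
Hypothesis vx_inj : forall r i j, (i <= len r)%N -> (j <= len r)%N ->
  vx r i = vx r j -> i = j.
Hypothesis star_rel : forall r i, (i < len r)%N ->
  arm_loop (arm_up beta vx r) (arm_dn beta vx r) i
  + arm_up beta vx r i * arm_dn beta vx r i = 0.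
Hypothesis arm_nbr : forall r i q, (i < len r)%N -> e (vx r i) q ->
  q = vx r i.+1 \/ exists2 j, i = j.+1 & q = vx r j.
Hypothesis hub_nbr : forall q, e c q -> exists r j, len r = j.+1 /\ q = vx r j.

(** By induction on the vertex h closest to the hub: a walk that visits it can be
    rotated to start there, and then is a power of the loop at h up to sign. *)
Lemma arm_closed_walk r h i s : (h <= len r)%N ->
  path e i s -> last i s = i -> s <> [::] ->
  (forall q, q \in s -> exists2 j, (j < h)%N & q = vx r j) ->
  T (walk_prod beta i s).
Proof.
elim: h i s => [|h IH] i s hl es li s0 sD.
  by case: s s0 es li sD => // j s _ _ _ /(_ j (mem_head _ _)) [].
have [hs|hs] := boolP (vx r h \in s); last first.
  apply: (IH i s (ltnW hl) es li s0) => q qs; have [j jh qE] := sD q qs.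
  exists j => //; rewrite ltn_neqAle -ltnS jh andbT.
  by apply: contraNneq hs => <-; rewrite -qE.
have [s' [es' ls' ss' +]] := rotate_closed_walk beta tkT es li hs.
apply; have s'0 : s' <> [::] by move=> s'0; move: hs; rewrite -ss' s'0.
pose D q := [exists j : 'I_h.+1, q == vx r j].
have := @walk_from_hub A V beta e (vx r h) unit (fun=> h) (fun=> vx r) (fun=> erefl)
  (fun _ i ih => star_rel (ltn_trans ih hl)) D s'.
case=> //.
- by move=> _ k q kh _; apply: arm_nbr; exact: ltn_trans hl.
- move=> q /existsP[j /eqP qE] /(arm_nbr hl)[qh|[k hk qk]]; last by exists tt, k.
  have : (j : nat) = h.+1.
    apply: (@vx_inj r); rewrite -?qE -?qh // ltnW // (leq_trans _ hl) //.
  by move=> jE; have := ltn_ord j; rewrite jE ltnn.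
- apply/allP => q; rewrite ss' => /sD [j jh ->]; apply/existsP.
  by exists (Ordinal jh).
- case=> _ ww.
  pose L := arm_loop (arm_up beta vx r) (arm_dn beta vx r) h.
  suff [b [n ->]] : exists b n, walk_prod beta (vx r h) s' = (-1) ^+ b * L ^+ n.+1.
    have TL := arm_loop_pow_trace (@star_rel r) tkT n (ltnW hl).
    rewrite -signr_odd; case: (odd b); rewrite ?mul1r // mulN1r; exact: (tkN tkT).
  elim: ww => {es' ls' ss' s'0} [a [o ->]|a b _ [m [n ->]] [o ->]|a _ [m [n ->]]].
  + by exists 0%N, 0%N; rewrite mul1r expr1.
  + by exists m, n.+1; rewrite -mulrA [in RHS]exprSr.
  + by exists m.+1, n; rewrite [(-1) ^+ m.+1]exprS -mulrA mulN1r.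
- case=> _ [k [w [kh ls _ _]]].
  move: ls; rewrite ls' => /(vx_inj (ltnW hl) (leq_trans (leq_subr _ _) (ltnW hl))) hE.
  have : (h - k.+1 < h)%N by rewrite ltn_subrL (leq_trans _ kh).
  by rewrite -hE ltnn.
Qed.

Lemma star_closed_walk i s :
  (forall q, q \in s -> q = c \/ exists r j, (j < len r)%N /\ q = vx r j) ->
  (forall a, hub_word beta len vx a -> T a) ->
  path e i s -> last i s = i -> s <> [::] -> T (walk_prod beta i s).
Proof.
move=> cover hubT es li s0.
have [cs|cs] := boolP (c \in s).
  have [s' [es' ls' ss' +]] := rotate_closed_walk beta tkT es li cs.
  apply; have s'0 : s' <> [::] by move=> s'0; move: cs; rewrite -ss' s'0.
  have := @walk_from_hub A V beta e c I len vx vx_len star_rel predT s'.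
  case=> // [r k q kl _|q _||[_ /hubT //]|]; first exact: arm_nbr.
  - exact: hub_nbr.
  - exact: all_predT.
  case=> r [k [w [kl lk _ _]]]; move: lk; rewrite ls' -(vx_len r) => /vx_inj.
  rewrite leqnn leq_subr => /(_ isT isT) lE.
  have : (len r - k.+1 < len r)%N by rewrite ltn_subrL (leq_trans _ kl).
  by rewrite -lE ltnn.
have is_ : i \in s by rewrite -li; case: s s0 {cover es li cs} => // j s' _; rewrite /= mem_last.
have [iE|[r [j [jl iE]]]] := cover i is_; first by rewrite iE in is_; rewrite is_ in cs.
apply: (@arm_closed_walk r (len r)) => // {li s0 is_ cover}.
elim: s i j jl iE es cs => // q s IH i j jl iE /= /andP[eiq es].
rewrite inE negb_or => /andP[cq cs] p.
have [j' j'l qE] : exists2 j', (j' < len r)%N & q = vx r j'.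
  rewrite iE in eiq; have [qE|[k jk qE]] := arm_nbr jl eiq; last first.
    by exists k => //; rewrite (leq_trans _ jl) // jk.
  exists j.+1 => //; rewrite ltn_neqAle jl andbT.
  by apply: contra_neq cq => jE; rewrite qE jE vx_len.
rewrite inE => /orP[/eqP ->|]; first by exists j'.
exact: (IH q j').
Qed.
End StarClosedWalks.

(** * Simply laced Dynkin diagrams as stars with three arms *)

Definition diagram_adj (d : diagram) : rel nat :=
  fun p q => ((p, q) \in d.2) || ((q, p) \in d.2).

Lemma mem_chain p q m : ((p, q) \in chain m) = (q == p.+1) && (q < m)%N.
Proof.
apply/mapP/andP => [[i + [-> ->]]|[/eqP -> pm]]; first by rewrite mem_iota; lia.
by exists p => //; rewrite mem_iota; lia.
Qed.

(** The chain 0 - ... - m.-1 with one more vertex m attached to c.  All diagrams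
    of finite type but the one-vertex diagram are of this form: in type A the
    additional vertex prolongs the chain. *)
Definition branched_chain (c m : nat) : diagram := (m.+1, rcons (chain m) (c, m)).

Lemma branched_chain_adj c m p q : diagram_adj (branched_chain c m) p q =
  [|| (q == p.+1) && (q < m)%N, (p == q.+1) && (p < m)%N,
      (p == c) && (q == m) | (q == c) && (p == m)].
Proof. by rewrite /diagram_adj !mem_rcons !inE !mem_chain !xpair_eqE; lia. Qed.

Lemma sum_over_list (A : nmodType) n (P : pred nat) (F : nat -> A) (l : seq nat) :
  uniq l -> (forall q, (q \in l) = (q < n)%N && P q) ->
  \sum_(q < n | P q) F q = \sum_(q <- l) F q.
Proof.
move=> lu lP; rewrite -(big_mkord P) -big_filter; apply: perm_big.
apply: uniq_perm => //; first by rewrite filter_uniq // iota_uniq.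
by move=> q; rewrite mem_filter mem_index_iota lP andbC.
Qed.

Variant arm := LeftArm | RightArm | BranchArm.

Definition arm_length (c m : nat) (r : arm) : nat :=
  match r with LeftArm => c | RightArm => (m.-1 - c)%N | BranchArm => 1 end.

(** Vertices of an arm are numbered from its tip, so that number [arm_length] is
    the hub c in each arm. *)
Definition arm_vertex (c m : nat) (r : arm) (i : nat) : nat :=
  match r with
  | LeftArm => i
  | RightArm => (m.-1 - i)%N
  | BranchArm => if i is 0 then m else c
  end.

Section BranchedChain.
Variables (A : pzRingType) (T : A -> Prop) (beta : nat -> nat -> A) (c m : nat).
Hypothesis tkT : trace_kernel T.
Hypothesis cm : (c < m)%N.
Hypothesis vertex_rel : forall p, (p < m.+1)%N ->
  \sum_(q < m.+1 | diagram_adj (branched_chain c m) p q) beta p q * beta q p = 0.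
Local Notation len := (arm_length c m).
Local Notation vx := (arm_vertex c m).
Local Notation up := (arm_up beta vx).
Local Notation dn := (arm_dn beta vx).

Lemma arm_vertex_rel r i : (i < len r)%N ->
  arm_loop (up r) (dn r) i + up r i * dn r i = 0.
Proof.
rewrite /arm_up /arm_dn; case: r => /= il.
- have pm : (i < m.+1)%N by lia.
  apply: etrans (vertex_rel pm).
  case: i il pm => [|i] il pm.
    rewrite (@sum_over_list _ _ _ (fun q => beta 0%N q * beta q 0%N) [:: 1%N]) //.
      by rewrite big_seq1 /= add0r.
    by move=> q; rewrite branched_chain_adj !inE; lia.
  rewrite (@sum_over_list _ _ _ (fun q => beta i.+1 q * beta q i.+1) [:: i; i.+2]) /=.
  + by rewrite big_cons big_seq1.
  + by rewrite inE andbT; lia.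
  + by move=> q; rewrite branched_chain_adj !inE; lia.
- have pm : (m.-1 - i < m.+1)%N by lia.
  apply: etrans (vertex_rel pm); case: i il pm => [|i] il pm.
    rewrite subn0 in pm *.
    rewrite (@sum_over_list _ _ _ (fun q => beta m.-1 q * beta q m.-1) [:: m.-1 - 1]%N) //.
      by rewrite big_seq1 /= add0r.
    by move=> q; rewrite branched_chain_adj !inE; lia.
  rewrite (@sum_over_list _ _ _ (fun q => beta (m.-1 - i.+1)%N q * beta q (m.-1 - i.+1)%N)
    [:: m.-1 - i; m.-1 - i.+2]%N) /=.
  + by rewrite big_cons big_seq1.
  + by rewrite inE andbT; lia.
  + by move=> q; rewrite branched_chain_adj !inE; lia.
- case: i il => // _; apply: etrans (vertex_rel (ltnSn m)).
  rewrite (@sum_over_list _ _ _ (fun q => beta m q * beta q m) [:: c]) //.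
    by rewrite big_seq1 /= add0r.
  by move=> q; rewrite branched_chain_adj !inE; lia.
Qed.

Local Notation x := (hub_loop beta len vx BranchArm).
Local Notation y := (hub_loop beta len vx LeftArm).
Local Notation z := (hub_loop beta len vx RightArm).

Lemma hub_rel : x + y + z = 0.
Proof.
apply: etrans (vertex_rel (ltnW cm)).
pose ly := if c is c'.+1 then [:: c'] else [::].
pose lz := if (c.+1 < m)%N then [:: c.+1] else [::].
rewrite (@sum_over_list _ _ _ (fun q => beta c q * beta q c) ([:: m] ++ ly ++ lz)).
- rewrite !big_cat big_seq1 /= addrA /hub_loop; congr (_ + _ + _).
  + rewrite /ly; case: (c) => [|c']; first by rewrite big_nil.
    by rewrite big_seq1.
  + rewrite /lz -[len RightArm]/(m.-1 - c)%N; case: ltnP => c1m; last first.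
      by have -> : (m.-1 - c = 0)%N by [lia]; rewrite big_nil.
    have -> : (m.-1 - c = (m.-1 - c.+1).+1)%N by lia.
    rewrite big_seq1 /= /arm_dn /arm_up /=.
    have -> : (m.-1 - (m.-1 - c.+1).+1 = c)%N by lia.
    by have -> : (m.-1 - (m.-1 - c.+1) = c.+1)%N by lia.
- rewrite /ly /lz; case: (c) (cm) => [|c'] c'm; case: ltnP => /= h;
    rewrite -?topredE /= ?inE ?negb_or; lia.
- move=> q; rewrite branched_chain_adj /ly /lz !mem_cat.
  case: (c) (cm) => [|c'] c'm; case: ltnP => /= h; rewrite ?(inE, in_nil); lia.
Qed.

Lemma branched_chain_loops :
  [/\ x + y + z = 0, x * x = 0, y ^+ c.+1 = 0, z ^+ (m - c) = 0 &
      forall r n, T (hub_loop beta len vx r ^+ n.+1)].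
Proof.
have nil r := arm_loop_nilpotent (@arm_vertex_rel r) (leqnn _).
split; first exact: hub_rel.
- exact: (nil BranchArm).
- exact: (nil LeftArm).
- have -> : (m - c = (m.-1 - c).+1)%N by lia.
  exact: (nil RightArm).
- move=> r n; exact: (arm_loop_pow_trace (@arm_vertex_rel r) tkT).
Qed.

Lemma branched_chain_closed_walk i s :
  (forall a, words (one_of3 x y z) a -> T a) ->
  path (diagram_adj (branched_chain c m)) i s -> last i s = i -> s <> [::] ->
  T (walk_prod beta i s).
Proof.
move=> wordsT es; apply: (star_closed_walk (c := c) (len := len) (vx := vx)) (es) => //.
- by case=> //=; lia.
- by case=> [i' j|i' j|[|[|i']] [|[|j]]] //=; lia.
- exact: arm_vertex_rel.
- case=> [] k q /= kl; rewrite branched_chain_adj => h.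
  + have [qE|qk] := eqVneq q k.+1; [by left | right; exists q => //; lia].
  + have [qE|qk] := eqVneq q (m.-1 - k.+1)%N; [by left | right; exists k.-1; lia].
  + by case: k kl h => // _ h; left; lia.
- move=> q; rewrite branched_chain_adj => h.
  have [->|qm] := eqVneq q m; first by exists BranchArm, 0%N.
  have [qc|cq] := ltnP q c; first by exists LeftArm, q; split=> //=; lia.
  by exists RightArm, (m.-1 - c).-1; split=> /=; lia.
- move=> q qs; have qm : (q < m.+1)%N.
    elim: s i es qs => // j s IH i /= /andP[eij es]; rewrite inE => /orP[/eqP ->|].
      by move: eij; rewrite branched_chain_adj; lia.
    exact: IH es.
  have [qc|cq|->] := ltngtP q c; [right|right|by left].
    by exists LeftArm, q.
  have [->|qm'] := eqVneq q m; first by exists BranchArm, 0%N.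
  by exists RightArm, (m.-1 - q)%N => /=; split; lia.
- move=> a wa; apply: wordsT; elim: wa => {a} [a [r ->]|a b _ IH [r ->]|a _].
  + by apply: words_gen; case: r; [apply: Or32|apply: Or33|apply: Or31].
  + by apply: words_mul => //; case: r; [apply: Or32|apply: Or33|apply: Or31].
  + exact: words_opp.
Qed.
End BranchedChain.

Lemma chainS m : chain m.+2 = rcons (chain m.+1) (m, m.+1).
Proof.
have iotaS : iota 0 m.+1 = rcons (iota 0 m) m by rewrite -cats1 -[m.+1]addn1 iotaD.
by rewrite /chain [m.+2.-1]/= iotaS map_rcons.
Qed.

Lemma finite_diagramE t : valid_dynkin t ->
  t = DynA 1 \/ exists c m, [/\ (c < m)%N, finite_diagram t = branched_chain c m &
    match t with
    | DynA _ => m = c.+1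
    | DynD _ => m = c.+2
    | DynE6 => c = 2 /\ m = 5
    | DynE7 => c = 2 /\ m = 6
    | DynE8 => c = 2 /\ m = 7
    end]%N.
Proof.
case: t => [[|[|n]]|[|[|[|n]]]|||] // _; first by left.
- by right; exists n, n.+1; rewrite /branched_chain -chainS.
- by right; exists n, n.+2; rewrite /finite_diagram !subSS subn0.
- by right; exists 2, 5.
- by right; exists 2, 6.
- by right; exists 2, 7.
Qed.

(** The case of an undeformed algebra of finite type, for an arbitrary family of
    ring elements satisfying the preprojective relations. *)
Lemma dynkin_closed_walk (A : pzRingType) (T : A -> Prop) (t : dynkin)
    (beta : nat -> nat -> A) i s :
  trace_kernel T -> valid_dynkin t ->
  (forall p, prime p -> bad_for_type p t -> torsion_free T p) ->
  let d := finite_diagram t in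
  (forall p, (p < d.1)%N ->
     \sum_(q < d.1 | diagram_adj d p q) beta p q * beta q p = 0) ->
  path (diagram_adj d) i s -> last i s = i -> s <> [::] ->
  T (walk_prod beta i s).
Proof.
move=> tkT vt tf d vrel es li s0.
have [tA|[c [m [cm dE ct]]]] := finite_diagramE vt.
  by move: es; rewrite /d tA; case: s s0 {li}.
rewrite {}/d dE in vrel es.
have [xyz xx yc zc Tpow] := branched_chain_loops tkT cm vrel.
apply: (branched_chain_closed_walk tkT cm vrel _ es li s0) => a.
have Tx n := Tpow BranchArm n; have Ty n := Tpow LeftArm n; have Tz n := Tpow RightArm n.
have typeE : c = 2 -> (m - c <= 5)%N -> torsion_free T 2 -> torsion_free T 3 ->
    torsion_free T 5 \/ (m - c <= 4)%N ->
    words (one_of3 (hub_loop beta (arm_length c m) (arm_vertex c m) BranchArm)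
                   (hub_loop beta (arm_length c m) (arm_vertex c m) LeftArm)
                   (hub_loop beta (arm_length c m) (arm_vertex c m) RightArm)) a -> T a.
  move=> c2 mc tf2 tf3 tf5.
  have znil n : (m - c <= n)%N ->
      hub_loop beta (arm_length c m) (arm_vertex c m) RightArm ^+ n = 0.
    by move=> mn; rewrite -(subnK mn) exprD zc mulr0.
  apply: words_type_E => //.
  - by rewrite -mulrA -expr2 -exprS; have -> : 3%N = c.+1 by rewrite c2.
  - exact: znil.
  - by case: tf5 => [|mc4]; [left | right; exact: znil].
  - exact: (Tx 0%N).
case: t => [n|n|||] in vt tf dE ct typeE *.
- apply: words_type_A => //; rewrite -[RHS]zc ct subSn // subnn expr1 //.
- apply: words_type_D => //; first exact: tf.
  by rewrite -[RHS]zc ct -addn2 addnC addnK.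
- case: ct => cE mE; apply: typeE; rewrite ?cE ?mE //; [exact: tf|exact: tf|by right].
- case: ct => cE mE; apply: typeE; rewrite ?cE ?mE //; [exact: tf|exact: tf|by right].
- case: ct => cE mE; apply: typeE; rewrite ?cE ?mE //; [exact: tf|exact: tf|by left; exact: tf].
Qed.

(** * Products of paths *)

Section PathAlgebraProducts.
Variables (k : fieldType) (G : graph).
Implicit Types (i j : vtx G) (s t : seq (step G)).
Local Notation A := (pathalg k G).
Local Notation elt := (@path_elt k G).

Lemma path_elt_nwalk i s : ~~ walk i s -> elt i s = 0.
Proof. by move=> w; rewrite /path_elt insubF //; apply/negbTE. Qed.

Lemma path_eltM i s j t : elt i s * elt j t =
  if walk i s && (walk_end i s == j) then elt i (s ++ t) else 0.
Proof.
have [ws|ws] /= := boolP (walk i s); last by rewrite path_elt_nwalk // mul0r.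
have [wt|wt] := boolP (walk j t); last first.
  rewrite (path_elt_nwalk wt) mulr0; case: eqP => // jE.
  by rewrite path_elt_nwalk // walk_cat ws jE.
by rewrite (path_elt_walk _ ws) (path_elt_walk _ wt) [LHS]pamulU.
Qed.

Lemma idp_path_elt i j s : idp k i * elt j s = if i == j then elt j s else 0.
Proof. by rewrite path_eltM /=; case: eqP => [->|]. Qed.

Lemma path_elt_idp i s j : elt i s * idp k j = if walk_end i s == j then elt i s else 0.
Proof.
rewrite path_eltM cats0; have [//|w] := boolP (walk i s).
by rewrite (path_elt_nwalk w) if_same.
Qed.

Lemma pathalg_span (P : A -> Prop) : P 0 -> (forall c x y, P x -> P y -> P (c *: x + y)) ->
  (forall i s, walk i s -> P (elt i s)) -> forall x, P x.
Proof.
move=> P0 PZ Pp; apply: pathalg_ind => // c p x Px; apply: PZ => //.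
by rewrite -path_eltE; apply: Pp; exact: (valP p).
Qed.

(** The projection to the homogeneous component of degree n. *)
Definition length_part (n : nat) : A -> A :=
  lext (fun p => if size (steps p) == n then << p >> else 0).

Lemma length_part_path_elt n i s :
  length_part n (elt i s) = if size s == n then elt i s else 0.
Proof.
have [w|w] := boolP (walk i s); last by rewrite path_elt_nwalk // /length_part lext0 if_same.
by rewrite (path_elt_walk _ w) /length_part lextU.
Qed.

Lemma length_part_path_eltM n i s j t : length_part n (elt i s * elt j t) =
  if (size s + size t)%N == n then elt i s * elt j t else 0.
Proof.
rewrite path_eltM; case: ifP => _; last by rewrite /length_part lext0 if_same.
by rewrite length_part_path_elt size_cat.
Qed.

Definition theta_vertex i : A := \sum_a theta_at k i a.

Lemma theta_sum : theta k G = \sum_i theta_vertex i. Proof. by []. Qed.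

Lemma idp_theta_vertex i j : idp k i * theta_vertex j = if i == j then theta_vertex j else 0.
Proof.
rewrite !mulr_sumr; have [->|ij] := eqVneq i j.
  by apply: eq_bigr => a _; rewrite mulr_sumr; apply: eq_bigr => l _; rewrite idp_path_elt eqxx.
by rewrite big1 // => a _; rewrite mulr_sumr big1 // => l _; rewrite idp_path_elt (negPf ij).
Qed.

Lemma length_part_sandwich n i s j l t :
  length_part n (elt i s * theta_vertex l * elt j t) =
  if (size s + size t).+2 == n then elt i s * theta_vertex l * elt j t else 0.
Proof.
have lin (I : finType) (P : pred I) (F : I -> A) :
    (forall a, length_part n (elt i s * F a * elt j t) =
       if (size s + size t).+2 == n then elt i s * F a * elt j t else 0) ->
    length_part n (elt i s * (\sum_(a | P a) F a) * elt j t) =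
      if (size s + size t).+2 == n then elt i s * (\sum_(a | P a) F a) * elt j t else 0.
  move=> FE; rewrite !(mulr_sumr, mulr_suml) /length_part lext_sum.
  rewrite (eq_bigr _ (fun a _ => FE a)); case: ifP => // _.
  by rewrite big1.
apply: (lin) => a; apply: (lin) => q; rewrite [elt i s * _]path_eltM.
case: ifP => _; last by rewrite mul0r /length_part lext0 if_same.
by rewrite length_part_path_eltM size_cat /= addnAC addn2.
Qed.

Variable lam : vtx G -> k.
Local Notation proj := (preproj_proj lam).

Lemma preproj_theta_vertex i : proj (theta_vertex i) = lam i *: proj (idp k i).
Proof.
have e_theta : idp k i * theta k G = theta_vertex i.
  rewrite theta_sum mulr_sumr (bigD1 i) //= idp_theta_vertex eqxx big1 ?addr0 // => j ij.
  by rewrite idp_theta_vertex eq_sym (negPf ij).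
have e_weight : idp k i * weight lam = lam i *: idp k i.
  rewrite mulr_sumr (bigD1 i) //= -pascaleAr idp_path_elt eqxx big1 ?addr0 // => j ij.
  by rewrite -pascaleAr idp_path_elt eq_sym (negPf ij) scaler0.
rewrite -projZ -e_theta -e_weight; apply/projP; rewrite -mulrBr.
by apply: in_idealMl; apply/in_idealP; exists 1%N, (fun=> 1), (fun=> 1);
  rewrite big_ord1 mul1r mulr1.
Qed.
End PathAlgebraProducts.

(** * The undeformed algebra with some vertices killed *)

(** K is the set of deleted vertices: the record says that the full subgraph on
    the complement of K is the diagram d and has no multiple edges. *)
Record labelling (G : graph) (K : pred (vtx G)) (d : diagram)
    (label : vtx G -> nat) (vertex : nat -> vtx G) : Prop := Labelling {
  labelP : forall i, ~~ K i -> (label i < d.1)%N /\ vertex (label i) = i;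
  vertexP : forall p, (p < d.1)%N -> ~~ K (vertex p) /\ label (vertex p) = p;
  adjP : forall p q, (p < d.1)%N -> (q < d.1)%N ->
    diagram_adj d p q = [exists a, ends a == [set vertex p; vertex q]%SET];
  ends_inj : forall a b : edge G, (forall i, i \in ends a -> ~~ K i) ->
    ends a = ends b -> a = b
}.

Section Projection.
Variables (k : fieldType) (G : graph) (r : pathalg k G).
Local Notation pi := (@proj k G r).

Lemma projB x y : pi (x - y) = pi x - pi y.
Proof. by apply/(addIr (pi y)); rewrite -projD !subrK. Qed.

Lemma proj0 : pi 0 = 0.
Proof. by rewrite -(subrr 0) projB subrr. Qed.

Lemma proj_sum (I : Type) (s : seq I) (P : pred I) (F : I -> pathalg k G) :
  pi (\sum_(i <- s | P i) F i) = \sum_(i <- s | P i) pi (F i).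
Proof. exact: (big_morph pi (@projD _ _ _) proj0). Qed.

Lemma proj_generator x y : pi (x * r * y) = 0.
Proof.
rewrite -proj0; apply/projP; rewrite subr0; apply: in_idealM.
by apply/in_idealP; exists 1%N, (fun=> 1), (fun=> 1); rewrite big_ord1 mul1r mulr1.
Qed.
End Projection.

Section QuotientByVertices.
Variables (k : fieldType) (G : graph) (K : pred (vtx G)).
Local Notation A := (pathalg k G).
Local Notation elt := (@path_elt k G).

(** One relator is enough to kill both the vertices in K and the sum theta: the
    idempotents cut out its components, and those of theta at vertices in K
    vanish once these vertices do. *)
Definition relator : A := \sum_(i | K i) idp k i + \sum_(i | ~~ K i) theta_vertex k i.
Local Notation Q := (quot_alg relator).
Local Notation pi := (@proj k G relator).

Lemma proj_killed i : K i -> pi (idp k i) = 0.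
Proof.
move=> Ki; rewrite -(proj_generator relator (idp k i) 1) mulr1 mulrDr !mulr_sumr.
rewrite (bigD1 i) //= idp_path_elt eqxx !big1 ?addr0 // => j.
  by rewrite idp_theta_vertex; case: eqP => // <-; rewrite Ki.
by case/andP => _; rewrite idp_path_elt eq_sym => /negPf ->.
Qed.

Lemma proj_theta_vertex i : ~~ K i -> pi (theta_vertex k i) = 0.
Proof.
move=> Ki; rewrite -(proj_generator relator (idp k i) 1) mulr1 mulrDr !mulr_sumr addrC.
rewrite (bigD1 i) //= idp_theta_vertex eqxx !big1 ?addr0 // => j.
  by rewrite idp_path_elt; case: eqP => // <-; rewrite (negPf Ki).
by case/andP => _; rewrite idp_theta_vertex eq_sym => /negPf ->.
Qed.

(** Between vertices outside K there is at most one edge; the sum spares naming it. *)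
Definition arrow (i j : vtx G) : Q := pi (\sum_(a | ends a == [set i; j]%SET) elt i [:: (a, j)]).

Variables (d : diagram) (label : vtx G -> nat) (vertex : nat -> vtx G).
Hypothesis labelled : labelling K d label vertex.

Definition label_arrow (p q : nat) : Q := arrow (vertex p) (vertex q).

Lemma arrow_edge i j a : ~~ K i -> ~~ K j -> ends a = [set i; j]%SET ->
  arrow i j = pi (elt i [:: (a, j)]).
Proof.
move=> Ki Kj ea; rewrite /arrow (big_pred1 a) // => b /=.
rewrite -ea; apply/eqP/eqP => [/esym|-> //]; move/(ends_inj labelled) => -> //.
by move=> l; rewrite ea !inE => /orP[] /eqP ->.
Qed.

(** The relation at a vertex outside K is that of the ambient graph: paths to a
    vertex in K and back vanish in the quotient. *)
Lemma label_arrow_rel p : (p < d.1)%N ->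
  \sum_(q < d.1 | diagram_adj d p q) label_arrow p q * label_arrow q p = 0.
Proof.
move=> pd; have [Kp _] := vertexP labelled pd.
pose back j : A := \sum_(a | ends a == [set vertex p; j]%SET)
  elt (vertex p) [:: (a, j); (a, vertex p)].
have back_killed j : K j -> pi (back j) = 0.
  move=> Kj; rewrite proj_sum big1 // => a /eqP ea.
  have <- : elt (vertex p) [:: (a, j)] * idp k j * elt j [:: (a, vertex p)]
      = elt (vertex p) [:: (a, j); (a, vertex p)].
    by rewrite path_elt_idp eqxx path_eltM /= ea !eqxx.
  by rewrite !projM proj_killed // mulr0 mul0r.
have back_adj q : (q < d.1)%N -> diagram_adj d p q ->
    label_arrow p q * label_arrow q p = pi (back (vertex q)).
  move=> qd; have [Kq _] := vertexP labelled qd.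
  rewrite (adjP labelled pd qd) => /existsP[a /eqP ea].
  rewrite /label_arrow (arrow_edge Kp Kq ea) (arrow_edge (a := a) Kq Kp);
    last by rewrite finset.setUC.
  rewrite -projM path_eltM /= ea !eqxx /= /back (big_pred1 a) // => b /=.
  rewrite -ea; apply/eqP/eqP => [/esym|-> //]; move/(ends_inj labelled) => -> //.
  by move=> l; rewrite ea !inE => /orP[] /eqP ->.
have back_nadj q : (q < d.1)%N -> ~~ diagram_adj d p q -> pi (back (vertex q)) = 0.
  move=> qd; rewrite (adjP labelled pd qd) negb_exists => /forallP nadj.
  by rewrite proj_sum big_pred0 // => a; rewrite (negPf (nadj a)).
transitivity (\sum_(q < d.1) pi (back (vertex q))).
  rewrite big_mkcond; apply: eq_bigr => q _; case: ifP => adj; first exact: back_adj.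
  by rewrite back_nadj // adj.
transitivity (\sum_(j | ~~ K j) pi (back j)).
  rewrite (reindex (fun q : 'I_d.1 => vertex q)) /=.
    by apply: eq_bigl => q; have [-> _] := vertexP labelled (ltn_ord q).
  exists (fun j => insubd (Ordinal pd) (label j)) => [q _|j].
    have [_ lq] := vertexP labelled (ltn_ord q).
    by apply: val_inj; rewrite /= lq val_insubd ltn_ord.
  rewrite inE => Kj; have [lj vj] := labelP labelled Kj.
  by rewrite val_insubd lj.
transitivity (\sum_j pi (back j)).
  rewrite [RHS](bigID K) /= [X in _ = X + _]big1 ?add0r //.
have sumE : \sum_j back j = theta_vertex k (vertex p).
  by rewrite /back (exchange_big_dep xpredT).
by rewrite -proj_sum sumE proj_theta_vertex.
Qed.

Lemma proj_path_walk_prod i a j s : walk i ((a, j) :: s) ->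
  all (fun l => ~~ K l) (i :: j :: map snd s) ->
  pi (elt i ((a, j) :: s)) = walk_prod label_arrow (label i) (label j :: map label (map snd s)).
Proof.
have step_arrow i' a' j' : ~~ K i' -> ~~ K j' -> ends a' = [set i'; j']%SET ->
    pi (elt i' [:: (a', j')]) = label_arrow (label i') (label j').
  move=> Ki Kj ea; rewrite /label_arrow.
  have [_ ->] := labelP labelled Ki; have [_ ->] := labelP labelled Kj.
  by rewrite (arrow_edge Ki Kj ea).
elim: s i a j => [|[b l] s IH] i a j /=.
  by rewrite !andbT => /eqP ea /andP[Ki Kj]; rewrite mulr1; exact: step_arrow.
case/andP => /eqP ea w /and3P[Ki Kj Ks].
have -> : elt i [:: (a, j), (b, l) & s] = elt i [:: (a, j)] * elt j ((b, l) :: s).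
  by rewrite path_eltM /= ea !eqxx.
by rewrite projM step_arrow // IH //= Kj.
Qed.

Lemma label_path i s : walk i s -> all (fun l => ~~ K l) (i :: map snd s) ->
  path (diagram_adj d) (label i) (map label (map snd s)).
Proof.
elim: s i => //= -[a j] s IH i /= /andP[/eqP ea w] /and3P[Ki Kj Ks].
rewrite IH //= ?Kj // andbT.
have [li vi] := labelP labelled Ki; have [lj vj] := labelP labelled Kj.
by rewrite (adjP labelled li lj) vi vj; apply/existsP; exists a; rewrite ea.
Qed.

Lemma label_last i (s : seq (step G)) :
  last (label i) (map label (map snd s)) = label (walk_end i s).
Proof. by elim: s i => //= -[a j] s IH i /=. Qed.
End QuotientByVertices.

(** * Induction on the length of paths *)

(** S stands for the subspace that is to be all of the deformed algebra; K is empty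
    in finite type and consists of the extending vertex in affine type. *)
Section LengthInduction.
Variables (k : fieldType) (G : graph) (K : pred (vtx G)) (lam : vtx G -> k).
Local Notation A := (pathalg k G).
Local Notation elt := (@path_elt k G).
Local Notation prj := (preproj_proj lam).
Variable S : preproj lam -> Prop.
Hypothesis S0 : S 0.
Hypothesis S_lin : forall (c : k) u v, S u -> S v -> S (c *: u + v).
Hypothesis S_comm : forall u v, S (u * v - v * u).
Hypothesis S_idp : forall i, S (prj (idp k i)).
Hypothesis S_corner : forall i u, K i -> S (prj (idp k i) * u * prj (idp k i)).

Let SZ c u : S u -> S (c *: u).
Proof. by move=> Su; rewrite -[_ *: _]addr0; exact: S_lin. Qed.
Let SD u v : S u -> S v -> S (u + v).
Proof. by move=> Su; rewrite -[u]scale1r; exact: S_lin. Qed.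

Section FixedLength.
Variable n : nat.
Hypothesis IH : forall i s, (size s < n)%N -> S (prj (elt i s)).

(** The kernel of the trace on kG used in the inductive step for length n. *)
Definition length_part_in (x : A) : Prop := S (prj (length_part n x)).
Local Notation T0 := length_part_in.

Lemma length_part_in_lin c x y : T0 x -> T0 y -> T0 (c *: x + y).
Proof.
move=> Tx Ty; rewrite /T0 /length_part lextP.
by rewrite /preproj_proj projD projZ; exact: S_lin.
Qed.

Lemma length_part_in0 : T0 0.
Proof. by rewrite /T0 /length_part lext0 /preproj_proj proj0. Qed.

Lemma length_part_in_bilinear (F : A -> A -> A) :
  (forall c x y z, F (c *: x + y) z = c *: F x z + F y z) ->
  (forall c x y z, F z (c *: x + y) = c *: F z x + F z y) ->
  (forall i s j t, T0 (F (elt i s) (elt j t))) -> forall x y, T0 (F x y).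
Proof.
move=> Fl Fr Fp.
have F0l z : F 0 z = 0.
  have := Fl 1 0 0 z; rewrite !scale1r addr0 => /eqP.
  by rewrite -[X in X == _]addr0 (inj_eq (addrI _)) eq_sym => /eqP.
have F0r z : F z 0 = 0.
  have := Fr 1 0 0 z; rewrite !scale1r addr0 => /eqP.
  by rewrite -[X in X == _]addr0 (inj_eq (addrI _)) eq_sym => /eqP.
move=> x y; elim/pathalg_span: x => [|c x x' Tx Tx'|i s _]; first by rewrite F0l;
  exact: length_part_in0.
  by rewrite Fl; exact: length_part_in_lin.
elim/pathalg_span: y => [|c y y' Ty Ty'|j t _ //]; first by rewrite F0r; exact: length_part_in0.
by rewrite Fr; exact: length_part_in_lin.
Qed.

Lemma length_part_in_comm x y : T0 (x * y - y * x).
Proof.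
move: x y;
  apply: (@length_part_in_bilinear (fun x y => x * y - y * x)) => [c x y z|c x y z|i s j t].
- by rewrite mulrDl mulrDr -pascaleAl -pascaleAr scalerBr opprD addrACA.
- by rewrite mulrDl mulrDr -pascaleAl -pascaleAr scalerBr opprD addrACA.
- rewrite /T0 -[- _]scaleN1r addrC /length_part lextP -!/(length_part _ _).
  rewrite !length_part_path_eltM [(size t + _)%N]addnC scaleN1r addrC.
  case: ifP => _; last by rewrite subrr /preproj_proj proj0.
  by rewrite /preproj_proj projB !projM; exact: S_comm.
Qed.

(** A path a * b whose junction lies in K equals b * a modulo a commutator, and
    b * a lies in the corner at the junction. *)
Lemma length_part_in_through i s j t : K (walk_end i s) -> T0 (elt i s * elt j t).
Proof.
move=> Ks; rewrite /T0 length_part_path_eltM; case: ifP => _; last first.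
  by rewrite /preproj_proj proj0.
set e := walk_end i s; have [ej|ej] := eqVneq e j; last first.
  by rewrite path_eltM -/e (negPf ej) andbF /preproj_proj proj0.
have se : elt i s = elt i s * idp k e by rewrite path_elt_idp eqxx.
have et : elt j t = idp k e * elt j t by rewrite idp_path_elt ej eqxx.
rewrite -[prj _](subrK (prj (elt j t * elt i s))); apply: SD.
  by rewrite /preproj_proj !projM; exact: S_comm.
rewrite se et /preproj_proj !projM !mulrA -(mulrA (proj _ (idp k e))).
exact: S_corner.
Qed.

(** This is where the deformation enters: theta_l acts as the scalar lam l, which
    leaves a path shorter than n by two. *)
Lemma length_part_in_relator x y : T0 (x * relator k K * y).
Proof.
move: x y; apply: (@length_part_in_bilinear (fun x y => x * _ * y)) => [c x y z|c x y z|i s j t].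
- by rewrite !mulrDl -!pascaleAl.
- by rewrite mulrDr -pascaleAr.
have in_sum (I : finType) (P : pred I) (F : I -> A) :
    (forall a, P a -> T0 (elt i s * F a * elt j t)) ->
    T0 (elt i s * (\sum_(a | P a) F a) * elt j t).
  move=> TF; rewrite mulr_sumr mulr_suml; elim/big_ind: _ => // [|x y Tx Ty].
    exact: length_part_in0.
  by rewrite -[x]scale1r; exact: length_part_in_lin.
rewrite mulrDr mulrDl -[X in X + _]scale1r; apply: length_part_in_lin; apply: in_sum => l Kl.
  rewrite path_elt_idp; case: eqP => [el|_]; last by rewrite mul0r; exact: length_part_in0.
  by apply: length_part_in_through; rewrite el.
rewrite /T0 length_part_sandwich; case: eqP => [nE|_]; last by rewrite /preproj_proj proj0.
have -> : prj (elt i s * theta_vertex k l * elt j t) =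
    lam l *: prj (elt i s * idp k l * elt j t).
  rewrite /preproj_proj !projM -!/(preproj_proj lam _) preproj_theta_vertex.
  by rewrite -quot_scaleAr -quot_scaleAl.
apply: SZ; rewrite path_elt_idp; case: ifP => _; last by rewrite mul0r /preproj_proj proj0.
rewrite path_eltM; case: ifP => _; last by rewrite /preproj_proj proj0.
by apply: IH; rewrite size_cat -nE.
Qed.

Lemma length_part_in_ideal x : x \in in_ideal (relator k K) -> T0 x.
Proof.
move=> /in_idealP[m [a [b ->]]]; elim/big_ind: _ => [|x' y' Tx Ty|i _];
  first exact: length_part_in0.
  by rewrite -[x']scale1r; exact: length_part_in_lin.
exact: length_part_in_relator.
Qed.

Definition quotient_kernel (u : quot_alg (relator k K)) : Prop := T0 (repr u).
Local Notation T := quotient_kernel.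

Lemma quotient_kernel_proj x : T (proj (relator k K) x) <-> T0 x.
Proof.
have Tr := length_part_in_ideal (repr_proj (relator k K) x).
split=> [Tx|Tx].
  rewrite -[x](subKr (repr (proj (relator k K) x))) addrC -scaleN1r.
  exact: length_part_in_lin.
rewrite /T -[repr _](subrK x) -[X in X + _]scale1r; exact: length_part_in_lin.
Qed.

Lemma quotient_trace_kernel : trace_kernel T.
Proof.
split=> [|u v|u v].
- by rewrite -(proj0 (relator k K)); apply/quotient_kernel_proj; exact: length_part_in0.
- case: (proj_surj u) => x <-; case: (proj_surj v) => y <-.
  move=> /quotient_kernel_proj Tx /quotient_kernel_proj Ty; rewrite -projB.
  by apply/quotient_kernel_proj; rewrite addrC -scaleN1r; exact: length_part_in_lin.
- case: (proj_surj u) => x <-; case: (proj_surj v) => y <-.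
  by rewrite -!projM -projB; apply/quotient_kernel_proj; exact: length_part_in_comm.
Qed.

Lemma quotient_torsion_free p : p%:R != 0 :> k -> torsion_free T p.
Proof.
move=> p0 u; case: (proj_surj u) => x <-.
have -> : proj (relator k K) x *+ p = proj (relator k K) (p%:R *: x).
  by rewrite projZ -scaler_nat.
move=> /quotient_kernel_proj Tpx; apply/quotient_kernel_proj.
rewrite -[x]scale1r -(mulVf p0) -scalerA -[_ *: _]addr0.
by apply: length_part_in_lin => //; exact: length_part_in0.
Qed.
End FixedLength.

Variables (t : dynkin) (label : vtx G -> nat) (vertex : nat -> vtx G).
Hypothesis t_valid : valid_dynkin t.
Hypothesis labelled : labelling K (finite_diagram t) label vertex.
Hypothesis good : forall p, prime p -> bad_for_type p t -> p%:R != 0 :> k.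

Lemma split_at_killed i (s : seq (step G)) : ~~ all (fun l => ~~ K l) (i :: map snd s) ->
  exists s1 s2, s = s1 ++ s2 /\ K (walk_end i s1).
Proof.
elim: s i => [|[a j] s IHs] i /=; first by rewrite andbT negbK => Ki; exists [::], [::].
rewrite negb_and negbK => /orP[Ki|/IHs [s1 [s2 [-> Ks]]]]; first by exists [::], ((a, j) :: s).
by exists ((a, j) :: s1), s2.
Qed.

Lemma path_in_S i s : S (prj (elt i s)).
Proof.
move: {2}(size s) (leqnn (size s)) => n; elim/ltn_ind: n i s => n IHn i s sn.
have IH i' s' : (size s' < size s)%N -> S (prj (elt i' s')).
  move=> ss; have nn : (size s' < n)%N by exact: leq_trans sn.
  exact: IHn nn _ _ (leqnn _).
have T0E : length_part_in (size s) (elt i s) -> S (prj (elt i s)).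
  by rewrite /length_part_in length_part_path_elt eqxx.
have [w|w] := boolP (walk i s); last by rewrite path_elt_nwalk // /preproj_proj proj0.
case: s => [|[a j] s] in sn IH T0E w *; first exact: S_idp.
set s' := (a, j) :: s in sn IH T0E w *.
have [closed|nclosed] := eqVneq (walk_end i s') i; last first.
  have -> : prj (elt i s') = prj (idp k i) * prj (elt i s') - prj (elt i s') * prj (idp k i).
    rewrite /preproj_proj -!projM -projB idp_path_elt eqxx path_elt_idp (negPf nclosed).
    by rewrite subr0.
  exact: S_comm.
apply: T0E; have [avoid|] := boolP (all (fun l => ~~ K l) (i :: map snd s')); last first.
  move=> /split_at_killed [s1 [s2 [sE Ks]]].
  have -> : elt i s' = elt i s1 * elt (walk_end i s1) s2.
    by move: w; rewrite sE path_eltM eqxx andbT walk_cat => /andP[->].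
  exact: length_part_in_through.
apply/(quotient_kernel_proj IH); rewrite (proj_path_walk_prod k labelled w avoid).
apply: (dynkin_closed_walk (t := t)) => //.
- exact: quotient_trace_kernel.
- by move=> p pp bp; apply: quotient_torsion_free => //; exact: good.
- by move=> p pd; exact: (label_arrow_rel k labelled pd).
- exact: (label_path labelled w avoid).
- by rewrite -[label j :: _]/(map label (map snd s')) label_last closed.
Qed.

Lemma preproj_all_in_S u : S u.
Proof.
case: (proj_surj u) => x <-; elim/pathalg_span: x => [|c x y Sx Sy|i s _].
- by rewrite proj0.
- by rewrite projD projZ; exact: S_lin.
- exact: path_in_S.
Qed.
End LengthInduction.

(** * Labellings of graphs by diagrams *)

(** Listing each edge once, with its smaller end first, excludes multiple edges. *)
Definition simple_diagram (d : diagram) : bool :=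
  [&& (0 < d.1)%N, uniq d.2 & all (fun e => (e.1 < e.2 < d.1)%N) d.2].

Lemma branched_chain_simple c m : (c < m)%N ->
  simple_diagram (branched_chain c m).
Proof.
move=> cm; apply/and3P; split=> //.
  by rewrite rcons_uniq mem_chain ltnn andbF map_inj_uniq ?iota_uniq // => p q [].
by apply/allP => -[p q]; rewrite mem_rcons inE mem_chain xpair_eqE /=; lia.
Qed.

Lemma finite_diagram_simple t : valid_dynkin t -> simple_diagram (finite_diagram t).
Proof.
move=> /finite_diagramE[-> //|[c [m [cm -> _]]]].
exact: branched_chain_simple.
Qed.

Lemma has_diagram_labelling (G : graph) (d : diagram) :
  simple_diagram d -> has_diagram G d ->
  exists label vertex, labelling (G := G) pred0 d label vertex.
Proof.
move=> /and3P[d0 ud /allP ltd] [f [g [[f' fK f'K] gbij fg]]].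
have g_inj := bij_inj gbij; case: gbij => g' gK g'K.
have ed a : nth (0, 0)%N d.2 (g a) \in d.2 by rewrite mem_nth.
pose vertex p := f' (insubd (Ordinal d0) p).
have fv p : (p < d.1)%N -> f (vertex p) = p :> nat.
  by move=> pd; rewrite f'K val_insubd pd.
have v_inj r s : (r < d.1)%N -> (s < d.1)%N -> (vertex r == vertex s) = (r == s).
  by move=> rd sd; apply/eqP/eqP => [vv|-> //]; rewrite -(fv r) // vv fv.
have vf i : vertex (f i) = i by rewrite /vertex valKd fK.
have endsP a p : (p < d.1)%N -> (vertex p \in ends a) =
    (p \in [:: (nth (0, 0)%N d.2 (g a)).1; (nth (0, 0)%N d.2 (g a)).2]).
  by move=> pd; rewrite fg fv.
exists (fun i => f i), vertex; split=> [i _|p pd|p q pd qd|a b _ eab].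
- by rewrite vf.
- by rewrite fv.
- have endsE a : (ends a == [set vertex p; vertex q]%SET) =
      (nth (0, 0)%N d.2 (g a) \in [:: (p, q); (q, p)]).
    move: (ltd _ (ed a)) (endsP a); case: (nth _ _ _) => e1 e2 /= /andP[e12 e2d] eP.
    apply/eqP/idP => [ea|].
      have := eP p pd; have := eP q qd; rewrite ea !inE !eqxx orbT /= !xpair_eqE.
      have e1d := ltn_trans e12 e2d; have := eP e1 e1d; have := eP e2 e2d;
        rewrite ea !inE !eqxx orbT.
      rewrite !v_inj //.
      by lia.
    move=> epq; apply/setP => i; rewrite !inE -(vf i) eP //.
    rewrite !v_inj // !inE; move: epq; rewrite !inE !xpair_eqE.
    by lia.
  apply/idP/existsP => [|[a]]; last first.
    by rewrite endsE !inE => /orP[] /eqP eq; have := ed a; rewrite eq /diagram_adj => ->;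
      rewrite ?orbT.
  move=> adj; have [e [ein eE]] : exists e, e \in d.2 /\ (e \in [:: (p, q); (q, p)]).
    by case/orP: adj => h; [exists (p, q) | exists (q, p)]; rewrite !inE eqxx ?orbT.
  have ei : (index e d.2 < size d.2)%N by rewrite index_mem.
  by exists (g' (Ordinal ei)); rewrite endsE g'K /= nth_index.
- apply: g_inj; apply: val_inj; apply/eqP;
    rewrite -(nth_uniq (0, 0)%N (ltn_ord (g a)) (ltn_ord (g b)) ud).
  move: (ltd _ (ed a)) (endsP a) (ltd _ (ed b)) (endsP b); rewrite eab.
  case: (nth _ _ (g a)) (nth _ _ (g b)) => [a1 a2] [b1 b2] /= /andP[a12 a2d] aP /andP[b12 b2d] bP.
  have h r : (r < d.1)%N -> (r \in [:: a1; a2]) = (r \in [:: b1; b2]).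
    by move=> rd; rewrite -aP // -bP.
  have := h a1 (ltn_trans a12 a2d); have := h a2 a2d; have := h b1 (ltn_trans b12 b2d).
  by have := h b2 b2d; rewrite !inE xpair_eqE; lia.
Qed.

Lemma del_vertex_ends (G : graph) (i0 : vtx G) (a : edge (del_vertex i0)) :
  ends (val a) = [set val i | i in ends a]%SET.
Proof.
apply/setP => i; apply/idP/imsetP => [ia|[i' + ->]]; last by rewrite inE.
have ni : i != i0 by apply: contraTneq ia => ->; exact: (valP a).
by exists (Sub i ni); rewrite ?inE ?SubK.
Qed.

Lemma del_vertex_labelling (G : graph) (i0 : vtx G) d label vertex :
  labelling (G := del_vertex i0) pred0 d label vertex ->
  exists label' vertex', labelling (G := G) (pred1 i0) d label' vertex'.
Proof.
move=> [lP vP aP eP].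
exists (fun i => if insub i is Some i' then label i' else 0%N), (fun p => val (vertex p)).
split=> [i ni|p pd|p q pd qd|a b ka eab].
- by rewrite (insubT (fun i => i != i0) ni) /=; have [] := lP (Sub i ni) isT => ? ->.
- by have [_ lv] := vP p pd; rewrite valK lv /=; split=> //; exact: (valP (vertex p)).
- rewrite (aP p q pd qd); apply/existsP/existsP => -[a /eqP ea].
    by exists (val a); rewrite del_vertex_ends ea imsetU1 imset_set1.
  have na : i0 \notin ends a.
    by rewrite ea !inE negb_or ![i0 == _]eq_sym (valP (vertex p)) (valP (vertex q)).
  exists (Sub a na); apply/eqP; apply: (imset_inj val_inj).
  by rewrite -del_vertex_ends SubK ea imsetU1 imset_set1.
- have na : i0 \notin ends a by apply/negP => /ka; rewrite /= eqxx.
  have nb : i0 \notin ends b by rewrite -eab.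
  have /(congr1 val) : (Sub a na : edge (del_vertex i0)) = Sub b nb.
    apply: eP => //; apply: (imset_inj val_inj).
    by rewrite -!del_vertex_ends !SubK.
  by rewrite !SubK.
Qed.

(** * Deletion of an extending vertex preserves good primes *)

(** Three edges at one vertex.  Such a configuration persists when a graph is
    enlarged; it separates types D and E from affine type A. *)
Definition has_branching (V E : Type) (inc : V -> E -> bool) : Prop :=
  exists v a0 a1 a2, [/\ a0 <> a1, a0 <> a2, a1 <> a2, inc v a0 & inc v a1 && inc v a2].

(** Three edges at one vertex v, two of which can be prolonged beyond their other
    ends w1 and w2.  It separates type E from affine type D, where a branching
    vertex has at most one neighbour that is not a leaf. *)
Definition has_long_branching (V E : Type) (inc : V -> E -> bool) : Prop :=
  exists v a0 a1 a2 w1 b1 w2 b2,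
    [/\ [/\ a0 <> a1, a0 <> a2, a1 <> a2, inc v a0 & inc v a1 && inc v a2],
        [/\ w1 <> v, b1 <> a1 & inc w1 a1 && inc w1 b1] &
        [/\ w2 <> v, b2 <> a2 & inc w2 a2 && inc w2 b2]].

Section IncidenceMaps.
Variables (V E V' E' : Type) (inc : V -> E -> bool) (inc' : V' -> E' -> bool).
Variables (f : V -> V') (g : E -> E').
Hypotheses (f_inj : injective f) (g_inj : injective g).
Hypothesis fg : forall v a, inc v a -> inc' (f v) (g a).

Lemma has_branching_map : has_branching inc -> has_branching inc'.
Proof.
move=> [v [a0 [a1 [a2 [n01 n02 n12 i0 /andP[i1 i2]]]]]].
by exists (f v), (g a0), (g a1), (g a2); split; rewrite ?fg // => /g_inj.
Qed.

Lemma has_long_branching_map : has_long_branching inc -> has_long_branching inc'.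
Proof.
move=> [v [a0 [a1 [a2 [w1 [b1 [w2 [b2 [[n01 n02 n12 i0 /andP[i1 i2]]
  [nw1 nb1 /andP[j1 l1]] [nw2 nb2 /andP[j2 l2]]]]]]]]]]].
exists (f v), (g a0), (g a1), (g a2), (f w1), (g b1), (f w2), (g b2).
by split; split; rewrite ?fg //; first [move/g_inj | move/f_inj].
Qed.
End IncidenceMaps.

Definition graph_incidence (G : graph) (i : vtx G) (a : edge G) : bool := i \in ends a.

Definition diagram_incidence (d : diagram) (v k : nat) : bool :=
  (k < size d.2)%N && (v \in [:: (nth (0, 0)%N d.2 k).1; (nth (0, 0)%N d.2 k).2]).

Definition ord_incidence (d : diagram) (v : 'I_d.1) (k : 'I_(size d.2)) : bool :=
  diagram_incidence d v k.

Lemma del_vertex_incidence (G : graph) (i0 : vtx G) i (a : edge (del_vertex i0)) :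
  graph_incidence i a -> graph_incidence (val i) (val a).
Proof. by rewrite /graph_incidence inE. Qed.

Lemma diagram_to_graph (G : graph) (d : diagram) : has_diagram G d ->
  exists f g, [/\ injective f, injective g & forall v k,
    @ord_incidence d v k -> graph_incidence (G := G) (f v) (g k)].
Proof.
move=> [f [g [[f' fK f'K] [g' gK g'K] fg]]]; exists f', g'; split.
- exact: can_inj f'K.
- exact: can_inj g'K.
- by move=> v l /andP[_]; rewrite /graph_incidence fg f'K g'K.
Qed.

Lemma graph_to_diagram (G : graph) (d : diagram) : has_diagram G d ->
  exists f g, [/\ injective f, injective g & forall i a,
    graph_incidence (G := G) i a -> diagram_incidence d (f i) (g a)].
Proof.
move=> [f [g [/bij_inj fI /bij_inj gI fg]]].
exists (fun i => f i), (fun a => g a); split.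
- by move=> i j /val_inj /fI.
- by move=> a b /val_inj /gI.
- by move=> i a; rewrite /graph_incidence fg /diagram_incidence ltn_ord.
Qed.

Lemma nth_chain m l : (l < m.-1)%N -> nth (0, 0)%N (chain m) l = (l, l.+1).
Proof. by move=> lm; rewrite (nth_map 0%N) ?size_iota // nth_iota. Qed.

Lemma size_chain m : size (chain m) = m.-1.
Proof. by rewrite size_map size_iota. Qed.

Lemma branched_chain_incidence c m v l : (0 < m)%N ->
  diagram_incidence (branched_chain c m) v l =
  (l < m.-1)%N && ((v == l) || (v == l.+1)) || (l == m.-1) && ((v == c) || (v == m)).
Proof.
move=> m0; rewrite /diagram_incidence /= size_rcons nth_rcons size_chain !inE.
case: (ltngtP l m.-1) => /= lm; [by rewrite nth_chain //=; lia | by lia | by lia].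
Qed.

Lemma branched_chain_branching c m : (0 < c)%N -> (c.+1 < m)%N ->
  has_branching (@ord_incidence (branched_chain c m)).
Proof.
move=> c0 cm; have sz : size (branched_chain c m).2 = m.
  by rewrite size_rcons size_chain; lia.
have l1 : (c.-1 < size (branched_chain c m).2)%N by lia.
have l2 : (c < size (branched_chain c m).2)%N by lia.
have l3 : (m.-1 < size (branched_chain c m).2)%N by lia.
have vm : (c < m.+1)%N by lia.
exists (Ordinal vm : 'I_(branched_chain c m).1), (Ordinal l1), (Ordinal l2), (Ordinal l3).
have m0 : (0 < m)%N by lia.
by rewrite /ord_incidence !branched_chain_incidence //=; split; try (case; lia); lia.
Qed.

Lemma branched_chain_long_branching c m : (1 < c)%N -> (c.+2 < m)%N ->
  has_long_branching (@ord_incidence (branched_chain c m)).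
Proof.
move=> c0 cm; have sz : size (branched_chain c m).2 = m.
  by rewrite size_rcons size_chain; lia.
have l0 : (c.-2 < size (branched_chain c m).2)%N by lia.
have l1 : (c.-1 < size (branched_chain c m).2)%N by lia.
have l2 : (c < size (branched_chain c m).2)%N by lia.
have l3 : (c.+1 < size (branched_chain c m).2)%N by lia.
have l4 : (m.-1 < size (branched_chain c m).2)%N by lia.
have v0 : (c.-1 < m.+1)%N by lia.
have v1 : (c < m.+1)%N by lia.
have v2 : (c.+1 < m.+1)%N by lia.
exists (Ordinal v1 : 'I_(branched_chain c m).1), (Ordinal l4), (Ordinal l1), (Ordinal l2),
  (Ordinal v0), (Ordinal l0), (Ordinal v2), (Ordinal l3).
have m0 : (0 < m)%N by lia.
by rewrite /ord_incidence !branched_chain_incidence //=; split; split; try (case; lia); lia.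
Qed.

Lemma affine_A_no_branching n : ~ has_branching (diagram_incidence (affine_diagram (DynA n))).
Proof.
have incE v l : diagram_incidence (affine_diagram (DynA n)) v l =
    (l < n)%N && ((v == l) || (v == l.+1)) || (l == n) && ((v == n) || (v == 0%N)).
  rewrite /diagram_incidence /= size_rcons nth_rcons size_chain !inE.
  case: (ltngtP l n) => /= lm; [by rewrite nth_chain //=; lia | by lia | by lia].
move=> [v [a0 [a1 [a2 []]]]]; rewrite !incE; lia.
Qed.

(** A vertex on two edges is one of 1, ..., n - 3, and an edge between two such
    vertices belongs to the chain.  Only one edge of this kind meets either of
    the branching vertices 1 and n - 3. *)
Lemma affine_D_no_long_branching n : (4 <= n)%N ->
  ~ has_long_branching (diagram_incidence (affine_diagram (DynD n))).
Proof.
move=> n4; have incE v l : diagram_incidence (affine_diagram (DynD n)) v l =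
    [|| (l < n - 2)%N && ((v == l) || (v == l.+1)),
        (l == n - 2)%N && ((v == n - 3)%N || (v == n.-1)) |
        (l == n.-1) && ((v == 1%N) || (v == n))].
  rewrite /diagram_incidence /= size_cat size_chain nth_cat size_chain /= !inE.
  case: (ltnP l n.-1.-1) => /= lm; first by rewrite nth_chain //=; lia.
  case lE : (l - n.-1.-1)%N => [|[|r]] /=; lia.
have end_or_chain v l : diagram_incidence (affine_diagram (DynD n)) v l ->
    v = 1%N \/ v = (n - 3)%N \/ l = v \/ l.+1 = v by rewrite incE; lia.
have inner w l l' : diagram_incidence (affine_diagram (DynD n)) w l ->
    diagram_incidence (affine_diagram (DynD n)) w l' -> l' <> l -> (0 < w <= n - 3)%N.
  by rewrite !incE; lia.
have inner_edge v w l : diagram_incidence (affine_diagram (DynD n)) v l ->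
    diagram_incidence (affine_diagram (DynD n)) w l ->
    (0 < v <= n - 3)%N -> (0 < w <= n - 3)%N -> w <> v ->
    v = l /\ w = l.+1 \/ v = l.+1 /\ w = l.
  by rewrite !incE; lia.
move=> [v [a0 [a1 [a2 [w1 [b1 [w2 [b2 [[n01 n02 n12 i0 /andP[i1 i2]]
  [nw1 nb1 /andP[j1 l1]] [nw2 nb2 /andP[j2 l2]]]]]]]]]]].
have vin : (0 < v <= n - 3)%N by apply: (inner _ _ _ i0 i1); lia.
have e1 := inner_edge _ _ _ i1 j1 vin (inner _ _ _ j1 l1 nb1) nw1.
have e2 := inner_edge _ _ _ i2 j2 vin (inner _ _ _ j2 l2 nb2) nw2.
have w1in := inner _ _ _ j1 l1 nb1; have w2in := inner _ _ _ j2 l2 nb2.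
move: (end_or_chain _ _ i0) (end_or_chain _ _ i1) (end_or_chain _ _ i2).
clear -n01 n02 n12 vin e1 e2 w1in w2in; lia.
Qed.

(** The types t and t' need not correspond to each other: deleting an end of an
    arm of affine E8 may leave A8 or D8.  Types D and E never come from affine A,
    nor E from affine D, by the configurations above; for p = 5 the number of
    vertices forces t to be E8 when t' is E8. *)
Lemma bad_prime_del_vertex (G : graph) (i0 : vtx G) (t t' : dynkin) (p : nat) :
  of_affine_type G t -> of_finite_type (del_vertex i0) t' ->
  bad_for_type p t' -> bad_for_type p t.
Proof.
move=> [vt Gt] [vt' Gt'] bad.
have [f' [g' [f'I g'I fg']]] := diagram_to_graph Gt'.
have [f [g [fI gI fg]]] := graph_to_diagram Gt.
have branching : has_branching (@ord_incidence (finite_diagram t')) ->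
    has_branching (diagram_incidence (affine_diagram t)).
  move=> /(has_branching_map g'I fg').
  move=> /(has_branching_map val_inj (@del_vertex_incidence G i0)).
  exact: (has_branching_map gI fg).
have long_branching : has_long_branching (@ord_incidence (finite_diagram t')) ->
    has_long_branching (diagram_incidence (affine_diagram t)).
  move=> /(has_long_branching_map f'I g'I fg').
  move=> /(has_long_branching_map val_inj val_inj (@del_vertex_incidence G i0)).
  exact: (has_long_branching_map fI gI fg).
have card_eq : (affine_diagram t).1 = (finite_diagram t').1.+1.
  have [h [_ [h_bij _ _]]] := Gt; have [h' [_ [h'_bij _ _]]] := Gt'.
  have := bij_eq_card h_bij; have := bij_eq_card h'_bij; rewrite !card_ord => <- <-.
  by rewrite card_sig cardC1 prednK //; apply/card_gt0P; exists i0.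
have br : has_branching (@ord_incidence (finite_diagram t')).
  have [tA|[c [m [cm dE ct]]]] := finite_diagramE vt'; first by rewrite tA in bad.
  have d1 : (finite_diagram t').1 = m.+1 by rewrite dE.
  rewrite dE {dE}.
  apply: branched_chain_branching;
    case: t' vt' bad ct d1 {Gt' f' g' f'I g'I fg' branching long_branching card_eq} => //=; lia.
have notA n : t <> DynA n by move=> tA; move: (branching br); rewrite tA;
  exact: affine_A_no_branching.
have notD n : t = DynD n -> t' <> DynE6 /\ t' <> DynE7 /\ t' <> DynE8.
  move=> tD; have n4 : (4 <= n)%N by rewrite tD in vt.
  have no_long := @affine_D_no_long_branching n n4; rewrite tD in long_branching.
  split; [|split]; move=> t'E; apply: no_long; apply: long_branching; rewrite t'E.
  - exact: (@branched_chain_long_branching 2 5).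
  - exact: (@branched_chain_long_branching 2 6).
  - exact: (@branched_chain_long_branching 2 7).
case: t notA notD card_eq {vt Gt branching long_branching fg f g fI gI} =>
  [n|n|||] notA notD card_eq.
- by case: (notA n).
- by have [n6 [n7 n8]] := notD n erefl;
    case: t' bad n6 n7 n8 {vt' Gt' f' g' f'I g'I fg' card_eq br notD}.
- case: t' bad card_eq {vt' Gt' f' g' f'I g'I fg' br notD} => [n|n|||] //=.
  by move=> /eqP ->.
- case: t' bad card_eq {vt' Gt' f' g' f'I g'I fg' br notD} => [n|n|||] //=.
  by move=> /eqP ->.
- case: t' bad card_eq {vt' Gt' f' g' f'I g'I fg' br notD} => [n|n|||] //=.
  by move=> /eqP ->.
Qed.

(** * Commutators, corners and paths of length zero as subspaces *)

Section Subspaces.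
Local Open Scope classical_set_scope.
Variables (k : fieldType).

Definition subspace (V : lmodType k) (S : set V) : Prop :=
  S 0 /\ forall (c : k) u v, S u -> S v -> S (c *: u + v).

Lemma span_subspace (V : lmodType k) (S : set V) : subspace (span S).
Proof.
split=> [|c _ _ [m [a [u [Su ->]]]] [n [b [v [Sv ->]]]]].
  by exists 0%N, (fun=> 0), (fun=> 0); rewrite big_ord0; split=> // -[].
exists (m + n)%N,
  (fun i => match split i with inl i => c * a i | inr i => b i end),
  (fun i => match split i with inl i => u i | inr i => v i end); split.
  by move=> i; case: (split i).
rewrite big_split_ord /= scaler_sumr; congr (_ + _); apply: eq_bigr => i _.
  by rewrite (unsplitK (inl i)) scalerA.
by rewrite (unsplitK (inr i)).
Qed.

Lemma sub_span (V : lmodType k) (S : set V) : S `<=` span S.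
Proof.
by move=> v Sv; exists 1%N, (fun=> 1), (fun=> v); split=> //; rewrite big_ord1 scale1r.
Qed.

Lemma sumsp_subspace (V : lmodType k) (S T : set V) :
  subspace S -> subspace T -> subspace (sumsp S T).
Proof.
move=> [S0 SL] [T0 TL]; split=> [|c _ _ [x Sx [y Ty <-]] [x' Sx' [y' Ty' <-]]].
  by exists 0 => //; exists 0 => //; rewrite addr0.
exists (c *: x + x'); first exact: SL.
exists (c *: y + y'); first exact: TL.
by rewrite scalerDr addrACA.
Qed.

Lemma sumsp_l (V : lmodType k) (S T : set V) : subspace T -> S `<=` sumsp S T.
Proof. by move=> [T0 _] x Sx; exists x => //; exists 0 => //; rewrite addr0. Qed.

Lemma sumsp_r (V : lmodType k) (S T : set V) : subspace S -> T `<=` sumsp S T.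
Proof. by move=> [S0 _] x Tx; exists 0 => //; exists x => //; rewrite add0r. Qed.

Lemma zero_paths_subspace (G : graph) (lam : vtx G -> k) : subspace (zero_paths lam).
Proof.
have [S0 SL] := span_subspace (range (@idp k G)).
split=> [|c _ _ [x Sx <-] [y Sy <-]]; first by exists 0 => //; exact: proj0.
exists (c *: x + y); first exact: SL.
by rewrite /preproj_proj projD projZ.
Qed.

Lemma zero_paths_idp (G : graph) (lam : vtx G -> k) i :
  zero_paths lam (preproj_proj lam (idp k i)).
Proof. by exists (idp k i) => //; apply: sub_span; exists i. Qed.

Lemma preproj_corner_subspace (G : graph) (lam : vtx G -> k) i :
  subspace (preproj_corner lam i).
Proof.
split=> [|c _ _ [x _ <-] [y _ <-]]; first by exists 0 => //; rewrite mulr0 mul0r.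
exists (c *: x + y) => //.
by rewrite mulrDr mulrDl -(quot_scaleAr c (preproj_proj lam _) x) -quot_scaleAl.
Qed.
End Subspaces.

Lemma good_char_neq0 (k : fieldType) (G : graph) p :
  good_char k G -> prime p -> bad_prime p G -> p%:R != 0 :> k.
Proof. by move=> gk pp bp; apply/negP => p0; apply: (gk p) bp; rewrite inE pp. Qed.

Local Open Scope classical_set_scope.

Theorem theorem1p4 (k : fieldType) (G : graph) (lam : vtx G -> k) :
  (finite_ADE G -> good_char k G ->
     [set: preproj lam] = sumsp (commspan lam) (zero_paths lam)) /\
  (affine_ADE G -> good_char k G ->
     forall i0 : vtx G, extending i0 ->
     [set: preproj lam] =
       sumsp (sumsp (commspan lam) (preproj_corner lam i0)) (zero_paths lam)).
Proof.
have Bsp := zero_paths_subspace lam; have Csp := span_subspace (@commutators (preproj lam)).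
have Ccomm (u v : preproj lam) : commspan lam (u * v - v * u).
  by apply: sub_span; exists u => //; exists v.
split=> [[t [vt Gt]] gk|[t Gt] gk i0 [t' [vt' Gt']]]; apply/seteqP; split=> // u _.
- have [label [vertex labelled]] := has_diagram_labelling (finite_diagram_simple vt) Gt.
  have [S0 SL] := sumsp_subspace Csp Bsp.
  apply: (preproj_all_in_S S0 SL _ _ _ vt labelled) => //.
  + by move=> x y; apply: (sumsp_l Bsp); exact: Ccomm.
  + by move=> i; apply: (sumsp_r Csp); exact: zero_paths_idp.
  + by move=> p pp bp; apply: good_char_neq0 gk pp _; exists t => //; left.
- have [label' [vertex' labelled']] :=
    has_diagram_labelling (finite_diagram_simple vt') Gt'.
  have [label [vertex labelled]] := del_vertex_labelling labelled'.
  have Ksp := preproj_corner_subspace lam i0.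
  have CKsp := sumsp_subspace Csp Ksp.
  have [S0 SL] := sumsp_subspace CKsp Bsp.
  apply: (preproj_all_in_S S0 SL _ _ _ vt' labelled).
  + by move=> x y; apply: (sumsp_l Bsp); apply: (sumsp_l Ksp); exact: Ccomm.
  + by move=> i; apply: (sumsp_r CKsp); exact: zero_paths_idp.
  + by move=> i x /eqP ->; apply: (sumsp_l Bsp); apply: (sumsp_r Csp); exists x.
  + move=> p pp bp; apply: good_char_neq0 gk pp _; exists t; first by right.
    exact: bad_prime_del_vertex Gt (conj vt' Gt') bp.
Qed.
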